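(* Let $K$ be a field and give $\mathscr T_K$ its natural $\mathbb Z$-grading $\mathscr T_K=\bigoplus_{n\in\mathbb Z}(\mathscr T_K)_n$. For $n\in\mathbb Z$, put $F_n=\operatorname{span}_K\{F_{ij}:i-j=n\}$. Then $$(\mathscr T_K)_n=Ke^n\oplus F_n\ \text{ if } n>0,\qquad (\mathscr T_K)_0=K1\oplus F_0,\qquad (\mathscr T_K)_n=K(e^* )^{-n}\oplus F_n\ \text{ if } n<0.$$ Moreover, $F=\bigoplus_{n\in\mathbb Z}F_n$, and $\mathfrak s$ is graded, with homogeneous components $\mathfrak s_n=F_n$ for $n\neq0$ and $\mathfrak s_0=\{\sum_ia_iF_{ii}:\sum_ia_i=0\}$ (finite sums, $a_i\in K$). The graded Lie ideals of $\mathscr T_K^-$ are precisely: $0$; $K1$; the spaces $\mathfrak s+U$, where $U$ is a graded subspace of $P_K\oplus Kw$ and $w\notin U$; and the spaces $\rho^{-1}(W)$, where $W$ is a graded subspace of $K[t,t^{-1}]$.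
   Context: Let $K$ be a field. The algebraic Toeplitz algebra $\mathscr T_K$ is the Leavitt path algebra over $K$ of the graph with two vertices $v,w$ and two edges, $e$ from $v$ to $v$ and $f$ from $v$ to $w$. Concretely, it is the associative unital $K$-algebra generated by $v,w,e,f,e^*,f^*$ subject to: $1=v+w$; $v^2=v$, $w^2=w$, $vw=wv=0$; $ve=ev=e$, $vf=fw=f$, $ve^*=e^*v=e^*$, $wf^*=f^*v=f^*$; $e^*e=v$, $f^*f=w$, $e^*f=f^*e=0$; $v=ee^*+ff^*$. The natural $\mathbb Z$-grading of $\mathscr T_K$ is the algebra grading with $\deg v=\deg w=0$, $\deg e=\deg f=1$, $\deg e^*=\deg f^*=-1$; $(\mathscr T_K)_n$ is the component of degree $n$. A subspace $S$ of $\mathscr T_K$ is graded if $S=\bigoplus_n(S\cap(\mathscr T_K)_n)$. The grading of $K[t,t^{-1}]$ is the standard one, with degree $n$ component $Kt^n$, and graded subspaces are defined likewise. $\mathscr T_K^-$ is the Lie algebra on $\mathscr T_K$ with bracket $[a,b]=ab-ba$. A Lie ideal of $\mathscr T_K^-$ is a $K$-subspace $L$ with $[a,x]\in L$ for all $a\in\mathscr T_K$, $x\in L$; a graded Lie ideal is a Lie ideal that is a graded subspace. Put $\alpha_1=\alpha_1^*=w$ and, for $i\ge2$, $\alpha_i=e^{i-2}f$ and $\alpha_i^*=f^*(e^* )^{i-2}$ (so $\alpha_2=f$, $\alpha_2^*=f^*$). For $i,j\ge1$ let $F_{ij}=\alpha_i\alpha_j^*$. $F=\bigoplus_{i,j\ge1}KF_{ij}$,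 which equals the two-sided ideal generated by $w$, and $\mathfrak s=[F,F]$ is the $K$-span of all $[a,b]$ with $a,b\in F$. $\rho:\mathscr T_K\to K[t,t^{-1}]$ is the $K$-algebra homomorphism with $\rho(v)=1$, $\rho(e)=t$, $\rho(e^* )=t^{-1}$, $\rho(w)=\rho(f)=\rho(f^* )=0$. $P_K=K1$ if $\operatorname{char}K=0$, and $P_K=\operatorname{span}_K\{1,e^{m\ell},(e^* )^{m\ell}:m\geq1\}$ if $\operatorname{char}K=\ell>0$. The sum $P_K+Kw$ inside $\mathscr T_K$ is direct. *)

(* Defs.v *)
From HB Require Import structures.
From mathcomp Require Import all_boot all_algebra.
From mathcomp Require Import generic_quotient.
From mathcomp Require Import finmap monalg.
From mathcomp Require Import boolp classical_sets.

Set Implicit Arguments.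
Unset Strict Implicit.
Unset Printing Implicit Defensive.

Import GRing.Theory.

Local Open Scope classical_set_scope.
Local Open Scope ring_scope.
Local Open Scope quotient_scope.

Section Subspaces.
Context {K : fieldType} {V : lmodType K}.
Implicit Types (A B S : set V) (x : V).

Definition subspace S :=
  S 0 /\ forall (a : K) x y, S x -> S y -> S (a *: x + y).

Definition span A : set V := smallest subspace A.

Definition line x : set V := range (fun a : K => a *: x).

Definition sumset A B : set V := [set a + b | a in A & b in B].

Definition dirsum2 S A B := S = sumset A B /\ A `&` B = [set 0].

(* S is the (internal) direct sum of the family of subspaces (A n). *)
Definition dirsum S (A : int -> set V) :=
  (S = [set x | exists (s : seq int) (a : int -> V),
                  (forall n, A n (a n)) /\ x = \sum_(n <- s) a n])
  /\ (forall (s : seq int) (a : int -> V),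
        uniq s -> (forall n, A n (a n)) -> \sum_(n <- s) a n = 0 ->
        {in s, forall n, a n = 0}).

(* Here V carries the grading with degree n component (C n). *)
Definition graded_subspace (C : int -> set V) S :=
  subspace S /\ dirsum S (fun n => S `&` C n).

Lemma span_subspace A : subspace (span A).
Proof.
split; first by move=> B [[]].
move=> a x y Ax Ay B BA; have [[_ BD] _] := BA.
by apply: BD; [apply: Ax | apply: Ay].
Qed.

End Subspaces.

Definition two_sided_ideal {K : fieldType} {A : lalgType K} (I : set A) :=
  subspace I /\ forall a x, I x -> I (a * x) /\ I (x * a).

Section Lie.
Context {K : fieldType} {A : algType K}.

Definition lie (a b : A) : A := a * b - b * a.

Definition lie_span (S S' : set A) : set A :=
  span [set lie a b | a in S & b in S'].

Definition lie_ideal (L : set A) :=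
  subspace L /\ forall a x, L x -> L (lie a x).

End Lie.

(* K[t,t^-1] as the group algebra of the integers: finitely supported functions
   int -> K. [monalg] only supplies a product for monoids without nontrivial
   units, so the convolution product is defined here. *)

Definition laurent (K : fieldType) : Type := {malg K[int]}.

HB.lock Definition laurent_mul (K : fieldType) (g1 g2 : {malg K[int]}) :
  {malg K[int]} :=
  \sum_(k1 <- msupp g1) \sum_(k2 <- msupp g2)
    << g1@_k1 * g2@_k2 *g k1 + k2 >>.

Section Laurent.
Context (K : fieldType).

HB.instance Definition _ := Choice.on (laurent K).
HB.instance Definition _ := GRing.Lmodule.on (laurent K).

Local Notation laurent_mul := (@laurent_mul K).
Implicit Types g : {malg K[int]}.

Lemma laurent_mulw (d1 d2 : {fset int}) g1 g2 :
  (msupp g1 `<=` d1)%fset -> (msupp g2 `<=` d2)%fset ->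
  laurent_mul g1 g2 =
    \sum_(k1 <- d1) \sum_(k2 <- d2) << g1@_k1 * g2@_k2 *g k1 + k2 >>.
Proof.
move=> le_d1 le_d2; rewrite laurent_mul.unlock (big_fset_incl _ le_d1) /=.
  apply/eq_bigr=> k1 _; apply/big_fset_incl => // k _ /mcoeff_outdom ->.
  by rewrite mulr0 monalgU0.
move=> k _ /mcoeff_outdom g1k.
by rewrite big1 => // k' _; rewrite g1k mul0r monalgU0.
Qed.

Let lmulU c1 c2 k1 k2 :
  laurent_mul << c1 *g k1 >> << c2 *g k2 >> = << c1 * c2 *g k1 + k2 >>.
Proof.
by rewrite (laurent_mulw msuppU_le msuppU_le) !big_seq_fset1 !mcoeffUU.
Qed.

Let lmulDl : left_distributive laurent_mul +%R.
Proof.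
move=> g1 g2 g; rewrite [in RHS](laurent_mulw (fsubsetUl _ (msupp g2))
  (fsubset_refl _)) [in RHS](laurent_mulw (fsubsetUr (msupp g1) _)
  (fsubset_refl _)) (laurent_mulw (msuppD_le _ _) (fsubset_refl _)).
rewrite -big_split /=; apply/eq_bigr=> k1 _.
rewrite -big_split /=; apply/eq_bigr=> k2 _.
by rewrite mcoeffD mulrDl monalgUD.
Qed.

Let lmulC : commutative laurent_mul.
Proof.
move=> g1 g2; rewrite laurent_mul.unlock exchange_big /=.
by apply/eq_bigr=> k1 _; apply/eq_bigr=> k2 _; rewrite mulrC addrC.
Qed.

Let lmulDr : right_distributive laurent_mul +%R.
Proof. by move=> g g1 g2; rewrite lmulC lmulDl !(lmulC _ g). Qed.

Let lmul0g : left_zero 0 laurent_mul.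
Proof. by move=> g; rewrite laurent_mul.unlock msupp0 big_seq_fset0. Qed.

Let lmulg0 : right_zero 0 laurent_mul.
Proof. by move=> g; rewrite lmulC lmul0g. Qed.

Let lmul_suml (I : Type) (r : seq I) (F : I -> {malg K[int]}) g :
  laurent_mul (\sum_(i <- r) F i) g = \sum_(i <- r) laurent_mul (F i) g.
Proof.
exact: (big_morph (laurent_mul^~ g) (fun x y => lmulDl x y g) (lmul0g g)).
Qed.

Let lmul_sumr (I : Type) (r : seq I) (F : I -> {malg K[int]}) g :
  laurent_mul g (\sum_(i <- r) F i) = \sum_(i <- r) laurent_mul g (F i).
Proof. exact: (big_morph (laurent_mul g) (lmulDr g) (lmulg0 g)). Qed.

Let lmulA : associative laurent_mul.
Proof.
move=> g1 g2 g3; rewrite [g1]monalgE !lmul_suml; apply/eq_bigr=> k1 _.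
rewrite [g2]monalgE lmul_suml !lmul_sumr lmul_suml; apply/eq_bigr=> k2 _.
rewrite [g3]monalgE !lmul_sumr; apply/eq_bigr=> k3 _.
by rewrite !lmulU mulrA addrA.
Qed.

Let lmul1g : left_id (<< 0 : int >> : {malg K[int]}) laurent_mul.
Proof.
move=> g; rewrite {1}[g]monalgE lmul_sumr [RHS]monalgE.
by apply/eq_bigr=> k _; rewrite lmulU mul1r add0r.
Qed.

Let l1_neq0 : (<< 0 : int >> : {malg K[int]}) != 0.
Proof. by rewrite monalgU_eq0 oner_eq0. Qed.

HB.instance Definition _ := GRing.Zmodule_isComNzRing.Build (laurent K)
  lmulA lmulC lmul1g lmulDl l1_neq0.

Let lscaleAl (c : K) (x y : laurent K) : c *: (x * y) = (c *: x) * y.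
Proof.
have mulc (z : laurent K) : c *: z = (<< c *g 0 : int >> : laurent K) * z.
  rewrite [LHS]malgZ_def /fgscale [in RHS]/GRing.mul /= [in RHS](monalgE z).
  by rewrite lmul_sumr; apply/eq_bigr=> i _; rewrite lmulU add0r.
by rewrite !mulc mulrA.
Qed.

HB.instance Definition _ := GRing.Lmodule_isLalgebra.Build K (laurent K)
  lscaleAl.
HB.instance Definition _ := GRing.Lalgebra_isComAlgebra.Build K (laurent K).

Definition laurent_t (n : int) : laurent K := << n >>.

Lemma laurent_tD m n : laurent_t (m + n) = laurent_t m * laurent_t n.
Proof. by rewrite /laurent_t /GRing.mul /= lmulU mulr1. Qed.

Lemma laurent_t0 : laurent_t 0 = 1.
Proof. by []. Qed.

Definition laurent_comp (n : int) : set (laurent K) := line (laurent_t n).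

End Laurent.

(* GES and GFS stand for e^* and f^*. *)
Inductive tgen : Type := GV | GW | GE | GF | GES | GFS.

Definition tgen_code (g : tgen) : nat :=
  match g with GV => 0 | GW => 1 | GE => 2 | GF => 3 | GES => 4 | GFS => 5 end.

Definition tgen_decode (n : nat) : tgen := nth GV [:: GV; GW; GE; GF; GES; GFS] n.

Lemma tgen_codeK : cancel tgen_code tgen_decode.
Proof. by case. Qed.

HB.instance Definition _ := Choice.copy tgen (can_type tgen_codeK).

Definition tgen_deg (g : tgen) : int :=
  match g with GV | GW => 0 | GE | GF => 1 | GES | GFS => -1 end.

Section FreeAlgebra.
Context (K : fieldType).

(* The wrapper keeps unification from unfolding the structures of [malg]. *)
Record free_alg : predArgType := FreeAlg { free_val : {malg K[{fmonom tgen}]} }.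

HB.instance Definition _ := [isNew for free_val].
HB.instance Definition _ := [Choice of free_alg by <:].

End FreeAlgebra.

HB.lock Definition free_add (K : fieldType) (x y : free_alg K) : free_alg K :=
  FreeAlg (free_val x + free_val y).
HB.lock Definition free_opp (K : fieldType) (x : free_alg K) : free_alg K :=
  FreeAlg (- free_val x).
HB.lock Definition free_mul (K : fieldType) (x y : free_alg K) : free_alg K :=
  FreeAlg (free_val x * free_val y).
HB.lock Definition free_scale (K : fieldType) (c : K) (x : free_alg K) :
  free_alg K := FreeAlg (c *: free_val x).

Section FreeAlgebraTheory.
Context (K : fieldType).
Local Notation free_alg := (free_alg K).

Let faE (x y : free_alg) : free_val (free_add x y) = free_val x + free_val y.
Proof. by rewrite unlock. Qed.

Let foE (x : free_alg) : free_val (free_opp x) = - free_val x.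
Proof. by rewrite unlock. Qed.

Let fmE (x y : free_alg) : free_val (free_mul x y) = free_val x * free_val y.
Proof. by rewrite unlock. Qed.

Let fsE c (x : free_alg) : free_val (free_scale c x) = c *: free_val x.
Proof. by rewrite unlock. Qed.

Let faddA : associative (@free_add K).
Proof. by move=> x y z; apply: val_inj; rewrite /= !faE addrA. Qed.

Let faddC : commutative (@free_add K).
Proof. by move=> x y; apply: val_inj; rewrite /= !faE addrC. Qed.

Let fadd0 : left_id (FreeAlg 0) (@free_add K).
Proof. by move=> x; apply: val_inj; rewrite /= faE add0r. Qed.

Let faddN : left_inverse (FreeAlg 0) (@free_opp K) (@free_add K).
Proof. by move=> x; apply: val_inj; rewrite /= faE foE addNr. Qed.

HB.instance Definition _ := GRing.isZmodule.Build free_alg faddA faddC fadd0 faddN.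

Let fscaleA a b (x : free_alg) :
  free_scale a (free_scale b x) = free_scale (a * b) x.
Proof. by apply: val_inj; rewrite /= !fsE scalerA. Qed.

Let fscale1 : left_id 1 (@free_scale K).
Proof. by move=> x; apply: val_inj; rewrite /= !fsE scale1r. Qed.

Let fscaleDr : right_distributive (@free_scale K) +%R.
Proof. by move=> c x y; apply: val_inj; rewrite /= !(fsE, faE) scalerDr. Qed.

Let fscaleDl (x : free_alg) : {morph (@free_scale K)^~ x : a b / a + b}.
Proof. by move=> a b; apply: val_inj; rewrite /= !(fsE, faE) scalerDl. Qed.

HB.instance Definition _ := GRing.Zmodule_isLmodule.Build K free_alg
  fscaleA fscale1 fscaleDr fscaleDl.

Let fmulA : associative (@free_mul K).
Proof. by move=> x y z; apply: val_inj; rewrite /= !fmE mulrA. Qed.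

Let fmul1 : left_id (FreeAlg 1) (@free_mul K).
Proof. by move=> x; apply: val_inj; rewrite /= fmE mul1r. Qed.

Let fmul1' : right_id (FreeAlg 1) (@free_mul K).
Proof. by move=> x; apply: val_inj; rewrite /= fmE mulr1. Qed.

Let fmulDl : left_distributive (@free_mul K) +%R.
Proof. by move=> x y z; apply: val_inj; rewrite /= !(fmE, faE) mulrDl. Qed.

Let fmulDr : right_distributive (@free_mul K) +%R.
Proof. by move=> x y z; apply: val_inj; rewrite /= !(fmE, faE) mulrDr. Qed.

Let fone_neq0 : FreeAlg (1 : {malg K[{fmonom tgen}]}) != 0.
Proof. by apply/eqP => /(congr1 (@free_val K)) /eqP; apply/negP; exact: oner_neq0. Qed.

HB.instance Definition _ := GRing.Zmodule_isNzRing.Build free_alg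
  fmulA fmul1 fmul1' fmulDl fmulDr fone_neq0.

Lemma free_valD (x y : free_alg) : free_val (x + y) = free_val x + free_val y.
Proof. exact: faE. Qed.

Lemma free_valN (x : free_alg) : free_val (- x) = - free_val x.
Proof. exact: foE. Qed.

Lemma free_valM (x y : free_alg) : free_val (x * y) = free_val x * free_val y.
Proof. exact: fmE. Qed.

Lemma free_valZ c (x : free_alg) : free_val (c *: x) = c *: free_val x.
Proof. exact: fsE. Qed.

Let fscaleAl (c : K) (x y : free_alg) : c *: (x * y) = (c *: x) * y.
Proof. by apply: val_inj; rewrite /= !(free_valZ, free_valM) scalerAl. Qed.

HB.instance Definition _ := GRing.Lmodule_isLalgebra.Build K free_alg fscaleAl.

Let malg_scaleAr (c : K) (x y : {malg K[{fmonom tgen}]}) :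
  c *: (x * y) = x * (c *: y).
Proof.
rewrite [x]monalgE !mulr_suml scaler_sumr; apply/eq_bigr => i _.
rewrite [y]monalgE mulr_sumr !scaler_sumr mulr_sumr; apply/eq_bigr => j _.
rewrite -!mul_malgC /GRing.mul /= !fgmulUU.
by rewrite !mul1m mulrCA.
Qed.

Let fscaleAr (c : K) (x y : free_alg) : c *: (x * y) = x * (c *: y).
Proof. by apply: val_inj; rewrite /= !(free_valZ, free_valM) malg_scaleAr. Qed.

HB.instance Definition _ := GRing.Lalgebra_isAlgebra.Build K free_alg fscaleAr.

End FreeAlgebraTheory.

HB.lock Definition free_gen (K : fieldType) (g : tgen) : free_alg K :=
  FreeAlg << fmu g >>.

Definition word_eval (K : fieldType) (A : algType K) (img : tgen -> A)
  (m : {fmonom tgen}) : A := \prod_(g <- (m : seq tgen)) img g.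

HB.lock Definition free_eval (K : fieldType) (A : algType K) (img : tgen -> A)
  (x : free_alg K) : A := mmap (in_alg A) (word_eval img) (free_val x).

Section Eval.
Context (K : fieldType) (A : algType K) (img : tgen -> A).
Local Notation free_alg := (free_alg K).
Local Notation word_eval := (@word_eval K A img).
Local Notation free_eval := (@free_eval K A img).

Lemma word_eval_mmorphism : mmorphism word_eval.
Proof.
by split=> [x y|]; rewrite /word_eval ?fmM ?big_cat // fm1 big_nil.
Qed.

HB.instance Definition _ :=
  isMultiplicative.Build {fmonom tgen} A word_eval word_eval_mmorphism.

Lemma free_eval_zmod : zmod_morphism free_eval.
Proof.
move=> x y; rewrite free_eval.unlock free_valD free_valN.
exact: (raddfB (mmap (in_alg A) word_eval)).
Qed.

Lemma free_eval_monoid : monoid_morphism free_eval.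
Proof.
have [|fM f1] := @commr_mmap_is_multiplicative _ _ _ (in_alg A) word_eval.
  by move=> g m m'; rewrite /GRing.comm /= mulr_algl mulr_algr.
by rewrite free_eval.unlock; split=> // x y; rewrite -fM -free_valM.
Qed.

Lemma free_eval_scale : scalable free_eval.
Proof. by move=> c x; rewrite free_eval.unlock free_valZ mmapZ /= mulr_algl. Qed.

HB.instance Definition _ :=
  GRing.isZmodMorphism.Build free_alg A free_eval free_eval_zmod.
HB.instance Definition _ :=
  GRing.isMonoidMorphism.Build free_alg A free_eval free_eval_monoid.
HB.instance Definition _ :=
  GRing.isScalable.Build K free_alg A *:%R free_eval free_eval_scale.

Lemma free_eval_gen g : free_eval (free_gen K g) = img g.
Proof.
by rewrite free_eval.unlock free_gen.unlock mmapU /= scale1r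
  mul1r /Defs.word_eval fmU big_seq1.
Qed.

End Eval.

Section ToeplitzDef.
Context (K : fieldType).

Local Notation A := (free_alg K).

Definition toep_rels : set A :=
  let v : A := free_gen K GV in let w : A := free_gen K GW in
  let e : A := free_gen K GE in let es : A := free_gen K GES in
  let f : A := free_gen K GF in let fs : A := free_gen K GFS in
  [set x | x \in
    [:: 1 - (v + w);
        v * v - v; w * w - w; v * w; w * v;
        v * e - e; e * v - e; v * f - f; f * w - f;
        v * es - es; es * v - es; w * fs - fs; fs * v - fs;
        es * e - v; fs * f - w; es * f; fs * e;
        v - (e * es + f * fs)]].

Definition toep_ideal : set A :=
  smallest (@two_sided_ideal K A) toep_rels.

Lemma toep_ideal_two_sided : two_sided_ideal toep_ideal.
Proof.
split.
  split; first by move=> J [[[]]].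
  move=> a x y Jx Jy J JP; have [[[_ JD] _] _] := JP.
  by apply: JD; [apply: Jx | apply: Jy].
move=> a x Jx; split=> J JP; have [[_ JM] _] := JP.
  exact: (JM a x (Jx J JP)).1.
exact: (JM a x (Jx J JP)).2.
Qed.

Lemma toep_ideal0 : toep_ideal 0.
Proof. by case: toep_ideal_two_sided => -[]. Qed.

Lemma toep_idealZD (a : K) x y : toep_ideal x -> toep_ideal y -> toep_ideal (a *: x + y).
Proof. by case: toep_ideal_two_sided => -[] _ h _; apply: h. Qed.

Lemma toep_idealD x y : toep_ideal x -> toep_ideal y -> toep_ideal (x + y).
Proof. by move=> Ix Iy; rewrite -[x]scale1r; apply: toep_idealZD. Qed.

Lemma toep_idealZ a x : toep_ideal x -> toep_ideal (a *: x).
Proof. by move=> Ix; rewrite -[a *: x]addr0; apply: toep_idealZD => //; exact: toep_ideal0. Qed.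

Lemma toep_idealN x : toep_ideal x -> toep_ideal (- x).
Proof. by move=> Ix; rewrite -scaleN1r; apply: toep_idealZ. Qed.

Lemma toep_idealMl a x : toep_ideal x -> toep_ideal (a * x).
Proof. by move=> Ix; have [_ /(_ a x Ix)[]] := toep_ideal_two_sided. Qed.

Lemma toep_idealMr a x : toep_ideal x -> toep_ideal (x * a).
Proof. by move=> Ix; have [_ /(_ a x Ix)[]] := toep_ideal_two_sided. Qed.

Definition toep_eq (x y : A) : bool := `[< toep_ideal (x - y) >].

Let toep_eq_refl : reflexive toep_eq.
Proof. by move=> x; apply/asboolP; rewrite subrr; exact: toep_ideal0. Qed.

Let toep_eq_sym : symmetric toep_eq.
Proof.
by move=> x y; apply/asboolP/asboolP => h; rewrite -opprB; apply: toep_idealN.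
Qed.

Let toep_eq_trans : transitive toep_eq.
Proof.
move=> y x z /asboolP xy /asboolP yz; apply/asboolP.
by rewrite -(subrKA y); apply: toep_idealD.
Qed.

Canonical toep_equiv := EquivRel toep_eq toep_eq_refl toep_eq_sym toep_eq_trans.

Definition toeplitz : Type := {eq_quot toep_equiv}.

HB.instance Definition _ := Choice.on toeplitz.
HB.instance Definition _ := EqQuotient.on toeplitz.

End ToeplitzDef.

(* Locking the operations keeps unification from unfolding the quotient. *)
HB.lock Definition tpi (K : fieldType) (x : free_alg K) : toeplitz K :=
  \pi_(toeplitz K) x.
HB.lock Definition toep_add (K : fieldType) (x y : toeplitz K) : toeplitz K :=
  tpi (repr x + repr y).
HB.lock Definition toep_opp (K : fieldType) (x : toeplitz K) : toeplitz K :=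
  tpi (- repr x).
HB.lock Definition toep_mul (K : fieldType) (x y : toeplitz K) : toeplitz K :=
  tpi (repr x * repr y).
HB.lock Definition toep_scale (K : fieldType) (c : K) (x : toeplitz K) :
  toeplitz K := tpi (c *: repr x).

Definition rho_img (K : fieldType) (g : tgen) : laurent K :=
  match g with
  | GV => 1
  | GE => laurent_t K 1
  | GES => laurent_t K (-1)
  | GW | GF | GFS => 0
  end.

HB.lock Definition rho (K : fieldType) (x : toeplitz K) : laurent K :=
  free_eval (@rho_img K) (repr x).

Section Toeplitz.
Context (K : fieldType).

Local Notation A := (free_alg K).
Local Notation T := (toeplitz K).
Local Notation toep_ideal := (@toep_ideal K).
Local Notation toep_rels := (@toep_rels K).
Local Notation tpi := (@tpi K).
Local Notation toep_add := (@toep_add K).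
Local Notation toep_opp := (@toep_opp K).
Local Notation toep_mul := (@toep_mul K).
Local Notation toep_scale := (@toep_scale K).
Local Notation rho_img := (@rho_img K).
Local Notation rho := (@rho K).

Let tpiE x y : toep_ideal (x - y) <-> tpi x = tpi y.
Proof.
split=> [h|/eqP]; first by apply/eqP; rewrite tpi.unlock eqmodE; apply/asboolP.
by rewrite tpi.unlock eqmodE => /asboolP.
Qed.

Let tpi_repr (x : T) : tpi (repr x) = x.
Proof. by rewrite tpi.unlock reprK. Qed.

Let repr_tpi (x : A) : toep_ideal (repr (tpi x) - x).
Proof. by apply/tpiE; rewrite tpi_repr. Qed.

Let addE x y : toep_add (tpi x) (tpi y) = tpi (x + y).
Proof. by rewrite toep_add.unlock; apply/tpiE; rewrite opprD addrACA; apply: toep_idealD. Qed.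

Let oppE x : toep_opp (tpi x) = tpi (- x).
Proof. by rewrite toep_opp.unlock; apply/tpiE; rewrite -opprD; apply: toep_idealN. Qed.

Let mulE x y : toep_mul (tpi x) (tpi y) = tpi (x * y).
Proof.
rewrite toep_mul.unlock; apply/tpiE.
rewrite -(subrKA (repr (tpi x) * y)) -mulrBr -mulrBl.
by apply: toep_idealD; [apply: toep_idealMl | apply: toep_idealMr].
Qed.

Let scaleE c x : toep_scale c (tpi x) = tpi (c *: x).
Proof. by rewrite toep_scale.unlock; apply/tpiE; rewrite -scalerBr; apply: toep_idealZ. Qed.

Let addA : associative toep_add.
Proof.
by move=> x y z; rewrite -[x]tpi_repr -[y]tpi_repr -[z]tpi_repr !addE addrA.
Qed.

Let addC : commutative toep_add.
Proof. by move=> x y; rewrite -[x]tpi_repr -[y]tpi_repr !addE addrC. Qed.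

Let add0 : left_id (tpi 0) toep_add.
Proof. by move=> x; rewrite -[x]tpi_repr addE add0r. Qed.

Let addN : left_inverse (tpi 0) toep_opp toep_add.
Proof. by move=> x; rewrite -[x]tpi_repr oppE addE addNr. Qed.

HB.instance Definition _ := GRing.isZmodule.Build T addA addC add0 addN.

Let scaleA a b x : toep_scale a (toep_scale b x) = toep_scale (a * b) x.
Proof. by rewrite -[x]tpi_repr !scaleE scalerA. Qed.

Let scale1 : left_id 1 toep_scale.
Proof. by move=> x; rewrite -[x]tpi_repr scaleE scale1r. Qed.

Let tpiD x y : tpi (x + y) = tpi x + tpi y.
Proof. by rewrite -addE. Qed.

Let scaleDr : right_distributive toep_scale +%R.
Proof.
move=> c x y; rewrite -[x]tpi_repr -[y]tpi_repr -tpiD !scaleE -tpiD.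
by rewrite scalerDr.
Qed.

Let scaleDl x : {morph toep_scale^~ x : a b / a + b}.
Proof. by move=> a b; rewrite -[x]tpi_repr !scaleE -tpiD scalerDl. Qed.

HB.instance Definition _ := GRing.Zmodule_isLmodule.Build K T
  scaleA scale1 scaleDr scaleDl.

Let mulA : associative toep_mul.
Proof.
by move=> x y z; rewrite -[x]tpi_repr -[y]tpi_repr -[z]tpi_repr !mulE mulrA.
Qed.

Let mul1 : left_id (tpi 1) toep_mul.
Proof. by move=> x; rewrite -[x]tpi_repr mulE mul1r. Qed.

Let mul1' : right_id (tpi 1) toep_mul.
Proof. by move=> x; rewrite -[x]tpi_repr mulE mulr1. Qed.

Let mulDl : left_distributive toep_mul +%R.
Proof.
move=> x y z; rewrite -[x]tpi_repr -[y]tpi_repr -[z]tpi_repr -tpiD !mulE -tpiD.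
by rewrite mulrDl.
Qed.

Let mulDr : right_distributive toep_mul +%R.
Proof.
move=> x y z; rewrite -[x]tpi_repr -[y]tpi_repr -[z]tpi_repr -tpiD !mulE -tpiD.
by rewrite mulrDr.
Qed.

Let rho_img_rels x : toep_rels x -> free_eval rho_img x = 0.
Proof.
have t1 : laurent_t K 1 * laurent_t K (-1) = 1 by rewrite -laurent_tD subrr.
have t2 : laurent_t K (-1) * laurent_t K 1 = 1 by rewrite mulrC.
have e1 : free_eval rho_img 1 = 1 by exact: rmorph1.
have eB y z : free_eval rho_img (y - z) = free_eval rho_img y - free_eval rho_img z.
  exact: rmorphB.
have eN y : free_eval rho_img (- y) = - free_eval rho_img y.
  exact: rmorphN.
have eD y z : free_eval rho_img (y + z) = free_eval rho_img y + free_eval rho_img z.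
  exact: rmorphD.
have eM y z : free_eval rho_img (y * z) = free_eval rho_img y * free_eval rho_img z.
  exact: rmorphM.
rewrite /toep_rels /= !inE; do !case/predU1P=> [->|]; last move=> /eqP->.
all: rewrite ?(eB, eD, eN, eM, e1, free_eval_gen) /=.
all: by rewrite ?t1 ?t2 ?(mul0r, mulr0, mul1r, mulr1, addr0, subrr).
Qed.

Lemma rho_img_ideal x : toep_ideal x -> free_eval rho_img x = 0.
Proof.
move=> Ix; apply: (Ix [set x | free_eval rho_img x = 0]).
split; last exact: rho_img_rels.
split=> [|a y /= yI]; last by rewrite !rmorphM /= yI mulr0 mul0r.
split=> [|a y z /= yI zI]; first exact: rmorph0.
by rewrite rmorphD /= linearZ /= yI zI scaler0 addr0.
Qed.

Let one_neq0 : tpi 1 != 0.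
Proof.
apply/eqP => /tpiE; rewrite subr0 => /rho_img_ideal /eqP.
by rewrite rmorph1 oner_eq0.
Qed.

HB.instance Definition _ := GRing.Zmodule_isNzRing.Build T
  mulA mul1 mul1' mulDl mulDr one_neq0.

Let tpiM x y : tpi (x * y) = tpi x * tpi y.
Proof. by rewrite -mulE. Qed.

Let tpiZ c x : tpi (c *: x) = c *: tpi x.
Proof. by rewrite -scaleE. Qed.

Let scaleAl (c : K) (x y : T) : c *: (x * y) = (c *: x) * y.
Proof.
by rewrite -[x]tpi_repr -[y]tpi_repr -tpiM -!tpiZ -tpiM scalerAl.
Qed.

HB.instance Definition _ := GRing.Lmodule_isLalgebra.Build K T scaleAl.

Let scaleAr (c : K) (x y : T) : c *: (x * y) = x * (c *: y).
Proof.
by rewrite -[x]tpi_repr -[y]tpi_repr -tpiM -!tpiZ -tpiM scalerAr.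
Qed.

HB.instance Definition _ := GRing.Lalgebra_isAlgebra.Build K T scaleAr.

Lemma tpi_zmod : zmod_morphism tpi.
Proof. by move=> x y; rewrite tpiD -scaleN1r tpiZ scaleN1r. Qed.

Lemma tpi_monoid : monoid_morphism tpi.
Proof. by split=> [|x y]; rewrite ?tpiM. Qed.

HB.instance Definition _ := GRing.isZmodMorphism.Build A T tpi tpi_zmod.
HB.instance Definition _ := GRing.isMonoidMorphism.Build A T tpi tpi_monoid.
HB.instance Definition _ := GRing.isScalable.Build K A T *:%R tpi tpiZ.

Lemma tpi_eq0 x : tpi x = 0 <-> toep_ideal x.
Proof. by split=> [/tpiE|Ix]; rewrite ?subr0 //; apply/tpiE; rewrite subr0. Qed.

Lemma tpi_surj (x : T) : exists y, tpi y = x.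
Proof. by exists (repr x). Qed.

Lemma rho_tpi x : rho (tpi x) = free_eval rho_img x.
Proof.
rewrite rho.unlock; apply/eqP; rewrite -subr_eq0; apply/eqP.
by rewrite -(rho_img_ideal (repr_tpi x)) rmorphB.
Qed.

Lemma rho_zmod : zmod_morphism rho.
Proof.
move=> x y; rewrite -[x]tpi_repr -[y]tpi_repr -rmorphB !rho_tpi.
exact: rmorphB.
Qed.

Lemma rho_monoid : monoid_morphism rho.
Proof.
split=> [|x y]; first by rewrite -(rmorph1 tpi) rho_tpi rmorph1.
rewrite -[x]tpi_repr -[y]tpi_repr -rmorphM !rho_tpi.
exact: rmorphM.
Qed.

Lemma rho_scale : scalable rho.
Proof.
by move=> c x; rewrite -[x]tpi_repr -tpiZ !rho_tpi linearZ.
Qed.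

HB.instance Definition _ := GRing.isZmodMorphism.Build T (laurent K) rho rho_zmod.
HB.instance Definition _ :=
  GRing.isMonoidMorphism.Build T (laurent K) rho rho_monoid.
HB.instance Definition _ :=
  GRing.isScalable.Build K T (laurent K) *:%R rho rho_scale.

Definition toep_gen (g : tgen) : T := tpi (free_gen K g).

Lemma rho_gen g : rho (toep_gen g) = rho_img g.
Proof. by rewrite rho_tpi free_eval_gen. Qed.

Lemma toep_rel x : toep_rels x -> tpi x = 0.
Proof. by move=> Rx; apply/tpi_eq0 => J [_]; apply. Qed.

Definition tv : T := toep_gen GV.
Definition tw : T := toep_gen GW.
Definition te : T := toep_gen GE.
Definition tf : T := toep_gen GF.
Definition tes : T := toep_gen GES.
Definition tfs : T := toep_gen GFS.

(* The algebra grading determined by the degrees of the generators: its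
   degree n component is spanned by the words of total degree n. *)
Definition toep_comp (n : int) : set T :=
  span [set x | exists s : seq tgen,
          \sum_(g <- s) tgen_deg g = n /\ x = \prod_(g <- s) toep_gen g].

(* Only the values at i >= 1 are meaningful. *)
Definition alpha (i : nat) : T :=
  match i with 0 => 0 | 1 => tw | k.+2 => te ^+ k * tf end.

Definition alphas (i : nat) : T :=
  match i with 0 => 0 | 1 => tw | k.+2 => tfs * tes ^+ k end.

Definition Fij (i j : nat) : T := alpha i * alphas j.

Definition toepF : set T :=
  span [set x | exists i j : nat, [/\ (1 <= i)%N, (1 <= j)%N & x = Fij i j]].

Definition toepFn (n : int) : set T :=
  span [set x | exists i j : nat,
          [/\ (1 <= i)%N, (1 <= j)%N, i%:Z - j%:Z = n & x = Fij i j]].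

Definition toep_s : set T := lie_span toepF toepF.

Definition toep_s0 : set T :=
  [set x | exists (N : nat) (a : nat -> K),
     \sum_(1 <= i < N) a i = 0 /\ x = \sum_(1 <= i < N) a i *: Fij i i].

(* The second set is empty in characteristic 0, [pchar K] being the set of
   primes l with l%:R = 0 in K. *)
Definition toepP : set T :=
  span ([set 1] `|`
        [set x | exists l m : nat, [/\ l \in [pchar K], (1 <= m)%N &
                   x = te ^+ (m * l) \/ x = tes ^+ (m * l)]]).

End Toeplitz.

Arguments tv : clear implicits.
Arguments tw : clear implicits.
Arguments te : clear implicits.
Arguments tf : clear implicits.
Arguments tes : clear implicits.
Arguments tfs : clear implicits.
Arguments toep_comp : clear implicits.
Arguments alpha : clear implicits.
Arguments alphas : clear implicits.
Arguments Fij : clear implicits.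
Arguments toepF : clear implicits.
Arguments toepFn : clear implicits.
Arguments toep_s : clear implicits.
Arguments toep_s0 : clear implicits.
Arguments toepP : clear implicits.
Arguments rho : clear implicits.
Arguments laurent_comp : clear implicits.
Arguments toep_gen : clear implicits.

(* Main.v *)
From HB Require Import structures.
Require Import Defs.
From mathcomp Require Import all_boot all_algebra.
From mathcomp Require Import boolp classical_sets.
From mathcomp Require Import finmap monalg zify.

(** Put S = e + f and S' = e^* + f^*.  Then S' S = 1, S S' = v and
    w = 1 - S S', so the algebra is the algebra of one-sided inverses: it is
    spanned by the monomials S^a S'^b, of degree a - b, and it acts on sequences
    by infinite matrices with S as the shift ([mono_ind], [toep_compE]).  The
    elements E i j = S^i w S'^j, which are the F_{i+1,j+1}, are matrix units
    spanning F, and S^a S'^b - S^(a+1) S'^(b+1) = E a b.  Modulo F the monomial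
    S^a S'^b is therefore the image of t^(a-b) under the section t^n |-> e^n
    (or (e^* )^(-n)) of rho, which gives ker rho = F ([rho_eq0]) and the
    description of the homogeneous components ([toep_compP]).

    The (i, j) entry of x is the scalar c with w S'^i x S^j w = c w; it is well
    defined because w <> 0 ([tw_neq0]).  Far down the diagonals the entries of x
    are the coefficients of rho x, so an element whose entries all vanish lies
    in F, hence is 0 ([entry_inj]).  As homogeneous elements of degree n are
    supported on the diagonal i - j = n, the sum of the components is direct.

    Modulo s every E i j with i <> j vanishes and every E i i is w, and w is not
    in s because commutators of finite matrices have trace 0 ([tw_notin_s]).
    Thus F = s + K w, a direct sum.  Moreover [T, T] is contained in F since
    K[t, t^-1] is commutative, [T, F] is contained in s ([lie_toepF_s]), and
    [(e^* )^n, e^n] is n w modulo s ([lie_tpow]).  The last fact is where P_K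
    comes from: P_K + K w + s is the set of x with [T, x] contained in s.

    Let L be a Lie ideal not contained in K 1.  An element commuting with all
    E i j is a scalar, so L meets F; bracketing a nonzero finite matrix with
    matrix units far from its support isolates one entry, so L contains
    off-diagonal matrix units and then all of s ([s_sub_lie_ideal]).  If w is in
    L then L contains F = ker rho and is the preimage of rho L
    ([lie_ideal_preimage]).  Otherwise, for a homogeneous x in L whose
    coefficient along e^n is c, the bracket with an element of degree -n gives
    c n w in L, so c n = 0 and x is in P_K + K w + s ([lie_ideal_sumset]). *)

Set Implicit Arguments.
Unset Strict Implicit.
Unset Printing Implicit Defensive.

Import GRing.Theory.

Local Open Scope classical_set_scope.
Local Open Scope ring_scope.

Local Notation span := Defs.span.

(** * Subspaces and gradings *)
Section SubspaceTheory.
Context (K : fieldType) (V : lmodType K).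
Implicit Types (A B S : set V) (x y : V).

Lemma subspaceZ S a x : subspace S -> S x -> S (a *: x).
Proof. by move=> [S0 SD] Sx; rewrite -[_ *: _]addr0; apply: SD. Qed.

Lemma subspaceD S x y : subspace S -> S x -> S y -> S (x + y).
Proof. by move=> [S0 SD] Sx Sy; rewrite -[x]scale1r; apply: SD. Qed.

Lemma subspaceN S x : subspace S -> S x -> S (- x).
Proof. by move=> Ss Sx; rewrite -scaleN1r; apply: subspaceZ. Qed.

Lemma subspaceB S x y : subspace S -> S x -> S y -> S (x - y).
Proof. by move=> Ss Sx Sy; apply: subspaceD => //; apply: subspaceN. Qed.

Lemma subspace_sum S (I : eqType) (r : seq I) (F : I -> V) :
  subspace S -> (forall i, i \in r -> S (F i)) -> S (\sum_(i <- r) F i).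
Proof.
move=> Ss SF; rewrite big_seq; elim/big_ind: _ => //; first by case: Ss.
by move=> x y; apply: subspaceD.
Qed.

Lemma span_ind A S : subspace S -> A `<=` S -> span A `<=` S.
Proof. by move=> Ss AS x; apply. Qed.

Lemma span_gen A : A `<=` span A.
Proof. by move=> x Ax B [_]; apply. Qed.

Lemma subspace_line x : subspace (line x).
Proof.
split=> [|a _ _ [b _ <-] [c _ <-]]; first by exists 0; rewrite ?scale0r.
by exists (a * b + c) => //; rewrite scalerDl scalerA.
Qed.

Lemma line_gen x : line x x.
Proof. by exists 1; rewrite ?scale1r. Qed.

Lemma subspace_sumset A B : subspace A -> subspace B -> subspace (sumset A B).
Proof.
move=> [A0 AD] [B0 BD]; split.
  by exists 0 => //; exists 0; rewrite ?addr0.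
move=> a _ _ [x Ax [y By <-]] [x' Ax' [y' By' <-]].
exists (a *: x + x'); first exact: AD.
by exists (a *: y + y'); [exact: BD | rewrite scalerDr addrACA].
Qed.

Lemma sumsetl A B : B 0 -> A `<=` sumset A B.
Proof. by move=> B0 x Ax; exists x => //; exists 0; rewrite ?addr0. Qed.

Lemma sumsetr A B : A 0 -> B `<=` sumset A B.
Proof. by move=> A0 x Bx; exists 0 => //; exists x; rewrite ?add0r. Qed.

Lemma subspaceI A B : subspace A -> subspace B -> subspace (A `&` B).
Proof.
move=> [A0 AD] [B0 BD]; split=> // a x y [Ax Bx] [Ay By].
by split; [apply: AD | apply: BD].
Qed.

End SubspaceTheory.

Lemma subspace_ker (K : fieldType) (V W : lmodType K) (f : {linear V -> W}) :
  subspace [set x | f x = 0].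
Proof.
split=> [|a x y /= fx fy]; first exact: linear0.
by rewrite linearP fx fy scaler0 addr0.
Qed.

Lemma subspace_preim (K : fieldType) (V W : lmodType K) (f : {linear V -> W})
  (S : set W) : subspace S -> subspace (f @^-1` S).
Proof.
move=> [S0 SD]; split=> [|a x y Sx Sy] /=; first by rewrite linear0.
by rewrite linearP; apply: SD.
Qed.

Section DirectSums.
Context (K : fieldType) (V : lmodType K).
Implicit Types (A C : int -> set V) (S : set V).

Definition independent A :=
  forall (s : seq int) (a : int -> V),
    uniq s -> (forall n, A n (a n)) -> \sum_(n <- s) a n = 0 ->
    {in s, forall n, a n = 0}.

(** Asking that x be the sum of the a n over every duplicate-free sequence large
    enough makes the property visibly stable under linear combinations: the
    sequences of two elements may simply be concatenated. *)
Lemma span_sums A x : (forall n, subspace (A n)) ->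
  span [set x | exists n, A n x] x ->
  exists (s : seq int) (a : int -> V),
    (forall n, A n (a n)) /\ x = \sum_(n <- s) a n.
Proof.
move=> As Ax.
suff [a [s [Aa xE]]] : exists (a : int -> V) (s : seq int),
    (forall n, A n (a n)) /\ forall s', uniq s' -> {subset s <= s'} ->
      x = \sum_(n <- s') a n.
  exists (undup s), a; split=> //; apply: xE; first exact: undup_uniq.
  by move=> n; rewrite mem_undup.
move: x Ax; apply: span_ind => [|x [m Ax]].
  split=> [|c x y [a [s [Aa xE]]] [b [t [Ab yE]]]].
    exists (fun=> 0), [::].
    by split=> [n|s' _ _]; [case: (As n) | rewrite big1].
  exists (fun n => c *: a n + b n), (s ++ t); split=> [n|s' us' sub_s'].
    by apply: (proj2 (As n)).
  rewrite big_split /= -scaler_sumr -xE -?yE // => n ns.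
    by rewrite sub_s' // mem_cat ns orbT.
  by rewrite sub_s' // mem_cat ns.
exists (fun n => if n == m then x else 0), [:: m]; split=> [n|s' us' sub_s'].
  by case: eqP => [->//|_]; case: (As n).
rewrite (bigD1_seq m) //=; last by apply: sub_s'; rewrite inE.
by rewrite eqxx big1 ?addr0 // => n /negPf->.
Qed.

Lemma dirsumI A S : (forall n, subspace (A n)) ->
  S = span [set x | exists n, A n x] -> independent A -> dirsum S A.
Proof.
move=> As SE indA; split=> //; apply/seteqP; split=> [x|_ [s [a [Aa ->]]]].
  by rewrite SE => /span_sums-/(_ As) [s [a [Aa xE]]]; exists s, a.
rewrite SE; apply: subspace_sum => [|n _]; first exact: span_subspace.
by apply: span_gen; exists n.
Qed.

(** Gradedness reduces to being spanned by homogeneous elements; this form is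
    stable under the constructions below. *)
Lemma graded_subspaceI C S : independent C -> (forall n, subspace (C n)) ->
  subspace S -> S `<=` span [set x | S x /\ exists n, C n x] ->
  graded_subspace C S.
Proof.
move=> indC Cs Ss SC; split=> //; apply: dirsumI.
- by move=> n; apply: subspaceI.
- apply/seteqP; split; last by apply: span_ind => // x [n []].
  move=> x /SC; move: x; apply: span_ind; first exact: span_subspace.
  by move=> x [Sx [n Cx]]; apply: span_gen; exists n.
by move=> s a us SCa; apply: indC => // n; case: (SCa n).
Qed.

Lemma graded_subspace_ind C S (P : set V) : graded_subspace C S ->
  subspace P -> (forall n x, S x -> C n x -> P x) -> S `<=` P.
Proof.
move=> [Ss [SE _]] Ps SCP x; rewrite {1}SE => -[s [a [SCa ->]]].
by apply: subspace_sum => // n _; case: (SCa n); exact: SCP.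
Qed.

End DirectSums.

(** * Brackets and products of spans *)
Section AlgebraSpans.
Context (K : fieldType) (A : algType K).
Implicit Types (a b x y : A) (L : set A).

Lemma lie_linearl b : linear (fun a => lie a b).
Proof.
move=> c x y; rewrite /lie mulrDl mulrDr -scalerAl -scalerAr opprD addrACA.
by rewrite -scalerBr.
Qed.

Lemma lie_linearr a : linear (lie a).
Proof.
move=> c x y; rewrite /lie mulrDl mulrDr -scalerAl -scalerAr opprD addrACA.
by rewrite -scalerBr.
Qed.

Lemma lieN a b : lie a b = - lie b a.
Proof. by rewrite opprB. Qed.

Lemma lieDr a x y : lie a (x + y) = lie a x + lie a y.
Proof. by rewrite -[x]scale1r lie_linearr !scale1r. Qed.

Lemma lie0r a : lie a 0 = 0. Proof. by rewrite /lie mulr0 mul0r subrr. Qed.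

Lemma lieZr a c x : lie a (c *: x) = c *: lie a x.
Proof. by rewrite -[_ *: _]addr0 lie_linearr lie0r addr0. Qed.

Lemma lie_scalar a c : lie a (c *: 1) = 0.
Proof. by rewrite lieZr /lie mulr1 mul1r subrr scaler0. Qed.

Lemma subspace_liel S x : subspace S -> subspace [set a : A | S (lie a x)].
Proof.
move=> [S0 SD]; split=> [|c a b Sa Sb] /=; first by rewrite lieN lie0r oppr0.
by rewrite lie_linearl; apply: SD.
Qed.

Lemma subspace_lier S a : subspace S -> subspace [set x : A | S (lie a x)].
Proof.
move=> [S0 SD]; split=> [|c x y Sa Sb] /=; first by rewrite lie0r.
by rewrite lie_linearr; apply: SD.
Qed.

Lemma subspace_mull S a : subspace S -> subspace [set x : A | S (a * x)].
Proof.
move=> [S0 SD]; split=> [|c x y Sx Sy] /=; first by rewrite mulr0.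
by rewrite mulrDr -scalerAr; apply: SD.
Qed.

Lemma subspace_mulr S x : subspace S -> subspace [set a : A | S (a * x)].
Proof.
move=> [S0 SD]; split=> [|c a b Sa Sb] /=; first by rewrite mul0r.
by rewrite mulrDl -scalerAl; apply: SD.
Qed.

Lemma span_mul (X Y S : set A) : subspace S ->
  (forall x y, X x -> Y y -> S (x * y)) ->
  forall x y, span X x -> span Y y -> S (x * y).
Proof.
move=> Ss XY x y Xx Yy.
move: x Xx; apply: span_ind => [|x Xx]; first exact: subspace_mulr.
move: y Yy; apply: span_ind => [|y Yy]; last exact: XY.
exact: subspace_mull.
Qed.

End AlgebraSpans.

(** * The vertex w is nonzero *)
Section Words.
Context (K : fieldType).

Definition free_word (s : seq tgen) : free_alg K := \prod_(g <- s) free_gen K g.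

Lemma free_valW s : free_val (free_word s) = << FMonom s >>.
Proof.
rewrite /free_word; elim: s => [|g s IHs].
  by rewrite big_nil; congr << _ *g _ >>; exact: fmoneE.
rewrite big_cons free_valM IHs free_gen.unlock /= malgM_def fgmulUU mulr1.
by congr << _ *g _ >>; apply/eqP; rewrite fmP fmM fmU.
Qed.

Lemma free_ind (P : set (free_alg K)) :
  subspace P -> (forall s, P (free_word s)) -> forall x, P x.
Proof.
move=> [P0 PD] Pw x.
have -> : x = \sum_(m <- msupp (free_val x)) (free_val x)@_m *: free_word m.
  apply: val_inj; rewrite /= [LHS]monalgE.
  have Dsum := big_morph (@free_val K) (@free_valD K) (erefl : free_val 0 = 0).
  rewrite Dsum; apply: eq_bigr => m _; rewrite free_valZ free_valW.
  apply/malgP => k; rewrite mcoeffZ !mcoeffU fmK.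
  by case: eqP; rewrite ?mulr1 ?mulr0.
elim/big_ind: _ => //.
  by move=> y z Py Pz; rewrite -[y]scale1r; apply: PD.
by move=> m _; rewrite -[_ *: _]addr0; apply: PD.
Qed.

Lemma toep_ind (P : set (toeplitz K)) :
  subspace P -> (forall s, P (\prod_(g <- s) toep_gen K g)) -> forall x, P x.
Proof.
move=> [P0 PD] Pw x; have [y <-] := tpi_surj x.
apply: (free_ind (P := [set y | P (tpi y)])).
  by split=> [|a y1 y2]; rewrite /= ?raddf0 // linearP; apply: PD.
by move=> s; rewrite /free_word /= rmorph_prod; apply: Pw.
Qed.

(** The generators act on the basis vectors delta_0, delta_1, ... of the space
    of finitely supported sequences, each sending a basis vector to another one
    or to zero, encoded by None. *)
Definition step (g : tgen) (k : nat) : option nat :=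
  match g, k with
  | GV, k.+1 => Some k.+1
  | GW, 0 => Some 0
  | GE, k.+1 => Some k.+2
  | GF, 0 => Some 1
  | GES, k.+2 => Some k.+1
  | GFS, 1 => Some 0
  | _, _ => None
  end.

Definition run (s : seq tgen) (o : option nat) : option nat :=
  foldr (fun g => obind (step g)) o s.

(** The coefficient of delta_0 in the image of delta_0. *)
Definition vac_coef (x : free_alg K) : K :=
  mmap idfun (fun m : {fmonom tgen} => (run m (Some 0%N) == Some 0%N)%:R)
    (free_val x).

Fact vac_coef_is_linear : scalar vac_coef.
Proof.
move=> c x y; rewrite /vac_coef free_valD free_valZ raddfD /=.
congr (_ + _); rewrite (mmapEw (msuppZ_le c _)) mmapE mulr_sumr.
by apply: eq_bigr => m _; rewrite mcoeffZ /= mulrA.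
Qed.

HB.instance Definition _ :=
  GRing.isLinear.Build K (free_alg K) K _ vac_coef vac_coef_is_linear.

Lemma vac_coefW s : vac_coef (free_word s) = (run s (Some 0%N) == Some 0%N)%:R.
Proof. by rewrite /vac_coef free_valW mmapU mul1r. Qed.

Lemma run_cat s1 s2 o : run (s1 ++ s2) o = run s1 (run s2 o).
Proof. exact: foldr_cat. Qed.

Lemma run_none s : run s None = None.
Proof. by elim: s => //= g s ->. Qed.

(** In this action both sides of each relation send every basis vector to the
    same vector. *)
Lemma vac_coef_rels x p q : toep_rels x -> vac_coef (p * x * q) = 0.
Proof.
move=> Rx.
apply: (free_ind (P := [set p | vac_coef (p * x * q) = 0])) => [|s /=].
  split=> [|a y z /= y0 z0]; first by rewrite /= !mul0r linear0.
  by rewrite !mulrDl -!scalerAl linearP /= y0 z0 mulr0 addr0.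
apply: (free_ind (P := [set q | vac_coef (free_word s * x * q) = 0]))
  => [|r /=].
  split=> [|a y z /= y0 z0]; first by rewrite /= !mulr0 linear0.
  by rewrite mulrDr -scalerAr linearP /= y0 z0 mulr0 addr0.
have W1 : 1 = free_word [::] by rewrite /free_word big_nil.
have Wg g : free_gen K g = free_word [:: g] by rewrite /free_word big_seq1.
have WM s1 s2 : free_word s1 * free_word s2 = free_word (s1 ++ s2).
  by rewrite /free_word big_cat.
move: Rx; rewrite /toep_rels /= !inE.
do !case/predU1P=> [->|]; last move=> /eqP->.
all: rewrite ?W1 ?Wg ?WM ?mulrBr ?mulrDr ?WM ?mulrBl ?mulrDl ?WM.
all: rewrite ?raddfB ?raddfD /= ?vac_coefW ?run_cat.
(* The three smallest states are where the partial maps have exceptions. *)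
all: by case: (run r _) => [[|[|[|k]]]|];
  rewrite /= ?run_none ?(oppr0, addr0, add0r, subrr).
Qed.

(** Multiplying on both sides turns the kernel of the functional into a
    two-sided ideal. *)
Lemma vac_coef_ideal x : toep_ideal x -> vac_coef x = 0.
Proof.
move=> Ix; suff /(_ 1 1): forall p q, vac_coef (p * x * q) = 0.
  by rewrite mul1r mulr1.
apply: (Ix [set x | forall p q, vac_coef (p * x * q) = 0]); split; last first.
  by move=> y Ry p q; apply: vac_coef_rels.
split=> [|a y /= y0]; last by split=> p q; rewrite !mulrA // -mulrA.
split=> [p q|a y z /= y0 z0 p q]; first by rewrite mulr0 mul0r linear0.
by rewrite mulrDr mulrDl -scalerAr -scalerAl linearP /= y0 z0 mulr0 addr0.
Qed.

Lemma tw_neq0 : tw K != 0.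
Proof.
apply/eqP => /tpi_eq0 /vac_coef_ideal.
have -> : free_gen K GW = free_word [:: GW] by rewrite /free_word big_seq1.
by rewrite vac_coefW => /eqP; rewrite oner_eq0.
Qed.

End Words.

(** * One-sided inverses and matrix units *)
Section Shift.
Context (K : fieldType).
Local Notation T := (toeplitz K).
Local Notation v := (tv K).
Local Notation w := (tw K).
Local Notation e := (te K).
Local Notation f := (tf K).
Local Notation es := (tes K).
Local Notation fs := (tfs K).

Definition shift : T := e + f.
Definition coshift : T := es + fs.
Local Notation S := shift.
Local Notation S' := coshift.

Fact relE :
  [/\ v + w = 1, v * v = v /\ w * w = w, v * w = 0 /\ w * v = 0,
      [/\ v * e = e, e * v = e, v * f = f & f * w = f] &
      [/\ v * es = es, es * v = es, w * fs = fs & fs * v = fs]]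
  /\ [/\ es * e = v, fs * f = w, es * f = 0 /\ fs * e = 0 &
      e * es + f * fs = v].
Proof.
pose gv := free_gen K GV; pose gw := free_gen K GW.
pose ge := free_gen K GE; pose gs := free_gen K GES.
pose gf := free_gen K GF; pose gt := free_gen K GFS.
pose rels := [:: 1 - (gv + gw);
  gv * gv - gv; gw * gw - gw; gv * gw; gw * gv;
  gv * ge - ge; ge * gv - ge; gv * gf - gf; gf * gw - gf;
  gv * gs - gs; gs * gv - gs; gw * gt - gt; gt * gv - gt;
  gs * ge - gv; gt * gf - gw; gs * gf; gt * ge;
  gv - (ge * gs + gf * gt)].
have R k (lt_k : (k < size rels)%N) : tpi rels`_k = 0.
  exact: toep_rel (mem_nth 0 lt_k).
have R0 k a b (lt_k : (k < size rels)%N) :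
    rels`_k = free_gen K a * free_gen K b -> toep_gen K a * toep_gen K b = 0.
  by move=> kE; have := R k lt_k; rewrite kE rmorphM.
have R1 k a b c (lt_k : (k < size rels)%N) :
    rels`_k = free_gen K a * free_gen K b - free_gen K c ->
    toep_gen K a * toep_gen K b = toep_gen K c.
  move=> kE; have := R k lt_k; rewrite kE rmorphB rmorphM => /eqP.
  by rewrite subr_eq0 => /eqP.
do !split.
- have := R 0 isT; rewrite /= rmorphB rmorphD rmorph1 => /eqP.
  by rewrite subr_eq0 => /eqP <-.
- exact: (@R1 1).
- exact: (@R1 2).
- exact: (@R0 3).
- exact: (@R0 4).
- exact: (@R1 5).
- exact: (@R1 6).
- exact: (@R1 7).
- exact: (@R1 8).
- exact: (@R1 9).
- exact: (@R1 10).
- exact: (@R1 11).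
- exact: (@R1 12).
- exact: (@R1 13).
- exact: (@R1 14).
- exact: (@R0 15).
- exact: (@R0 16).
have := R 17 isT; rewrite /= rmorphB rmorphD !rmorphM => /eqP.
by rewrite subr_eq0 => /eqP <-.
Qed.

Lemma vwD : v + w = 1. Proof. by have [[]] := relE. Qed.
Lemma wwE : w * w = w. Proof. by have [[_ []]] := relE. Qed.

Lemma coshiftK : S' * S = 1.
Proof.
have [_ [ee ff [ef fe] _]] := relE.
by rewrite /S' mulrDl !mulrDr ee ff ef fe addr0 add0r vwD.
Qed.

Lemma shiftV : S * S' = v.
Proof.
have [[_ _ [vw wv] [_ ev _ fw] [ves _ wfs _]] [_ _ _ vE]] := relE.
have efs : e * fs = 0 by rewrite -ev -wfs mulrA -(mulrA e) vw mulr0 mul0r.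
have fes : f * es = 0 by rewrite -fw -ves mulrA -(mulrA f) wv mulr0 mul0r.
by rewrite /S' mulrDl !mulrDr efs fes addr0 add0r.
Qed.

Lemma tw_def : w = 1 - S * S'.
Proof. by rewrite shiftV -vwD addrC addKr. Qed.

Lemma coshift_w : S' * w = 0.
Proof. by rewrite tw_def mulrBr mulrA coshiftK mul1r mulr1 subrr. Qed.

Lemma w_shift : w * S = 0.
Proof. by rewrite tw_def mulrBl -mulrA coshiftK mul1r mulr1 subrr. Qed.

Lemma shift_w : S * w = f.
Proof.
have [[_ _ [vw wv] [_ ev _ fw] _] _] := relE.
by rewrite mulrDl fw -ev -mulrA vw mulr0 add0r.
Qed.

Lemma w_coshift : w * S' = fs.
Proof.
have [[_ _ [vw wv] _ [ves _ wfs _]] _] := relE.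
by rewrite mulrDr wfs -ves mulrA wv mul0r add0r.
Qed.

Lemma teE : e = S - S * w. Proof. by rewrite shift_w addrK. Qed.
Lemma tesE : es = S' - w * S'. Proof. by rewrite w_coshift addrK. Qed.

Lemma coshift_shiftX a b :
  S' ^+ a * S ^+ b = if (a <= b)%N then S ^+ (b - a) else S' ^+ (a - b).
Proof.
elim: a b => [|a IHa] [|b]; rewrite ?expr0 ?mul1r ?mulr1 //.
by rewrite exprSr exprS mulrA -(mulrA _ S') coshiftK mulr1 IHa ltnS subSS.
Qed.

Lemma coshiftX_w n : S' ^+ n * w = w *+ (n == 0%N).
Proof.
by case: n => [|n]; rewrite ?mul1r // exprSr -mulrA coshift_w mulr0.
Qed.

Lemma w_shiftX n : w * S ^+ n = w *+ (n == 0%N).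
Proof.
by case: n => [|n]; rewrite ?mulr1 // exprS mulrA w_shift mul0r.
Qed.

Lemma w_mid i j : w * S' ^+ i * S ^+ j * w = w *+ (i == j).
Proof.
rewrite -(mulrA w) coshift_shiftX; case: leqP => ij.
  by rewrite w_shiftX mulrnAl wwE subn_eq0 eqn_leq ij.
by rewrite -mulrA coshiftX_w mulrnAr wwE subn_eq0 leqNgt ij gtn_eqF.
Qed.

End Shift.

(** The element F_{i+1,j+1}: indexing from 0 makes i and j exponents.  It is
    locked so that rewriting with associativity does not take it apart. *)
HB.lock Definition munit (K : fieldType) (i j : nat) : toeplitz K :=
  shift K ^+ i * tw K * coshift K ^+ j.

Section MatrixUnits.
Context (K : fieldType).
Local Notation T := (toeplitz K).
Local Notation v := (tv K).
Local Notation w := (tw K).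
Local Notation e := (te K).
Local Notation f := (tf K).
Local Notation es := (tes K).
Local Notation fs := (tfs K).
Local Notation S := (shift K).
Local Notation S' := (coshift K).
Local Notation E := (@munit K).

Lemma munitM i j k l : E i j * E k l = E i l *+ (j == k).
Proof.
rewrite !munit.unlock -[w in X in X * _]wwE !mulrA -(mulrA (S ^+ i)).
have -> : S ^+ i * (w * w) * S' ^+ j * S ^+ k * w =
  S ^+ i * w * (w * S' ^+ j * S ^+ k * w) by rewrite !mulrA.
by rewrite w_mid mulrnAr -(mulrA _ w w) wwE mulrnAl.
Qed.

Lemma munit00 : E 0 0 = w. Proof. by rewrite munit.unlock mulr1 mul1r. Qed.

Lemma alphaE i : alpha K i.+1 = S ^+ i * w.
Proof.
have fe0 : f * e = 0.
  have [[_ _ [vw wv] [ve ev vf fw] _] _] := relE K.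
  by rewrite -fw -ve -mulrA (mulrA w) wv mul0r mulr0.
have ff0 : f * f = 0.
  have [[_ _ [vw wv] [ve ev vf fw] _] _] := relE K.
  by rewrite -{1}fw -vf -mulrA (mulrA w) wv mul0r mulr0.
elim: i => [|i IHi]; first by rewrite mul1r.
rewrite exprS -mulrA -IHi /=; case: i {IHi} => [|i] /=.
  by rewrite mul1r shift_w.
rewrite mulrDl exprS mulrA; case: i => [|i]; rewrite ?expr0 ?mul1r ?mulr1.
  by rewrite ff0 addr0.
by rewrite exprS !mulrA fe0 !mul0r addr0.
Qed.

Lemma alphasE i : alphas K i.+1 = w * S' ^+ i.
Proof.
have ef0 : es * fs = 0.
  have [[_ _ [vw wv] _ [_ esv wfs _]] _] := relE K.
  by rewrite -esv -wfs -mulrA (mulrA v) vw mul0r mulr0.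
have ff0 : fs * fs = 0.
  have [[_ _ [vw wv] _ [_ esv wfs fsv]] _] := relE K.
  by rewrite -{1}fsv -wfs -mulrA (mulrA v) vw mul0r mulr0.
elim: i => [|i IHi]; first by rewrite mulr1.
rewrite exprSr mulrA -IHi /=; case: i {IHi} => [|i] /=.
  by rewrite mulr1 w_coshift.
rewrite mulrDr exprSr mulrA; case: i => [|i]; rewrite ?expr0 ?mul1r ?mulr1.
  by rewrite ff0 addr0.
by rewrite exprSr -!mulrA ef0 !mulr0 addr0.
Qed.

Lemma FijE i j : Fij K i.+1 j.+1 = E i j.
Proof.
by rewrite /Fij alphaE alphasE munit.unlock mulrA -(mulrA _ w w) wwE.
Qed.

Definition mono a b : T := S ^+ a * S' ^+ b.

Lemma monoM a b c d :
  mono a b * mono c d =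
  if (b <= c)%N then mono (a + (c - b)) d else mono a (b - c + d).
Proof.
rewrite /mono mulrA -(mulrA _ (S' ^+ b)) coshift_shiftX.
by case: ifP => _; rewrite exprD ?mulrA.
Qed.

(** The telescoping identity behind the decomposition of monomials modulo F. *)
Lemma munit_mono i j : E i j = mono i j - mono i.+1 j.+1.
Proof.
by rewrite munit.unlock tw_def mulrBr mulr1 mulrBl /mono exprSr exprS !mulrA.
Qed.

(** The degree n component described by monomials instead of arbitrary words. *)
Definition homog (n : int) : set T :=
  span [set x | exists a b : nat, a%:Z - b%:Z = n /\ x = mono a b].

Lemma homog_mono a b n : a%:Z - b%:Z = n -> homog n (mono a b).
Proof. by move=> abn; apply: span_gen; exists a, b. Qed.

Lemma homogM m n x y : homog m x -> homog n y -> homog (m + n) (x * y).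
Proof.
apply: span_mul => [|_ _ [a [b [abm ->]]] [c [d [cdn ->]]]].
  exact: span_subspace.
by rewrite monoM; case: leqP => bc; apply: homog_mono; lia.
Qed.

(** All generators come from the two inverses: v = S S', w = 1 - v, f = S w,
    f^* = w S', e = S - f and e^* = S' - f^*. *)
Lemma homog_gen g : homog (tgen_deg g) (toep_gen K g).
Proof.
have ss n : subspace (homog n) by exact: span_subspace.
have h1 : homog 0 1.
  by rewrite -[1]mulr1 -{1}(expr0 S) -(expr0 S'); apply: homog_mono.
have hS : homog 1 S.
  by rewrite -[S]mulr1 -{1}(expr1 S) -(expr0 S'); apply: homog_mono.
have hS' : homog (-1) S'.
  by rewrite -[S']mul1r -{1}(expr0 S) -(expr1 S'); apply: homog_mono.
have hv : homog 0 v by rewrite -shiftV -(subrr 1); apply: homogM.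
have hw : homog 0 w.
  by rewrite -[w](addKr v) vwD addrC; exact: subspaceB (ss 0) h1 hv.
have hf : homog 1 f by rewrite -shift_w; exact: homogM hS hw.
have hfs : homog (-1) fs by rewrite -w_coshift; exact: homogM hw hS'.
case: g => //=; [rewrite -[toep_gen _ _](addrK f) |
  rewrite -[toep_gen _ _](addrK fs)]; exact: subspaceB (ss _) _ _.
Qed.

Lemma homog_word s :
  homog (\sum_(g <- s) tgen_deg g) (\prod_(g <- s) toep_gen K g).
Proof.
elim: s => [|g s IHs]; last first.
  by rewrite !big_cons; apply: homogM => //; exact: homog_gen.
rewrite !big_nil -[1]mulr1 -{1}(expr0 S) -(expr0 S'); exact: homog_mono.
Qed.

Lemma mono_ind (P : set T) :
  subspace P -> (forall a b, P (mono a b)) -> forall x, P x.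
Proof.
move=> Ps Pm; apply: toep_ind => // s; move: (@homog_word s).
by apply: span_ind => // _ [a [b [_ ->]]].
Qed.

Lemma toep_compM m n x y :
  toep_comp K m x -> toep_comp K n y -> toep_comp K (m + n) (x * y).
Proof.
apply: span_mul => [|_ _ [r [rm ->]] [t [tn ->]]]; first exact: span_subspace.
by apply: span_gen; exists (r ++ t); rewrite !big_cat rm tn.
Qed.

Lemma toep_compE n : toep_comp K n = homog n.
Proof.
apply/seteqP; split=> x.
  apply: span_ind; first exact: span_subspace.
  by move=> _ [s [<- ->]]; exact: homog_word.
apply: span_ind => [|_ [a [b [<- ->]]]]; first exact: span_subspace.
have cg g : toep_comp K (tgen_deg g) (toep_gen K g).
  by apply: span_gen; exists [:: g]; rewrite !big_seq1.
have c1 : toep_comp K 0 1 by apply: span_gen; exists [::]; rewrite !big_nil.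
have cS : toep_comp K 1 S.
  exact: subspaceD (span_subspace _) (cg GE) (cg GF).
have cS' : toep_comp K (-1) S'.
  exact: subspaceD (span_subspace _) (cg GES) (cg GFS).
apply: toep_compM.
  elim: a => [|a IHa]; first by [].
  by rewrite exprS -add1n PoszD; apply: toep_compM.
elim: b => [|b IHb]; first by rewrite oppr0.
by rewrite exprS -add1n PoszD opprD; apply: toep_compM.
Qed.

End MatrixUnits.

(** * Matrix entries *)
Section Corner.
Context (K : fieldType).
Local Notation w := (tw K).

Lemma w_corner (x : toeplitz K) : exists c, w * x * w == c *: w.
Proof.
suff [c _ cE] : line w (w * x * w) by exists c; rewrite cE.
apply: (mono_ind (P := [set x | line w (w * x * w)])) => [|a b] /=.
  have [l0 lD] := subspace_line w.
  split=> [|c y z ly lz] /=; first by rewrite mulr0 mul0r.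
  by rewrite mulrDr mulrDl -scalerAr -scalerAl; apply: lD.
rewrite /mono mulrA w_shiftX -mulrA coshiftX_w mulrnAl mulrnAr wwE.
exists ((a == 0%N) && (b == 0%N))%:R => //; rewrite scaler_nat.
by case: (a == 0%N); case: (b == 0%N).
Qed.

End Corner.

HB.lock Definition vac (K : fieldType) (x : toeplitz K) : K :=
  xchoose (w_corner x).

Section Coefficients.
Context (K : fieldType).
Local Notation T := (toeplitz K).
Local Notation w := (tw K).
Local Notation S := (shift K).
Local Notation S' := (coshift K).
Local Notation E := (@munit K).
Implicit Types (x y : T).

Lemma vacE x : w * x * w = vac x *: w.
Proof. by rewrite unlock; exact/eqP/(xchooseP (w_corner x)). Qed.

Lemma scale_w_inj (a b : K) : a *: w = b *: w -> a = b.
Proof.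
move=> /eqP; rewrite -subr_eq0 -scalerBl scaler_eq0 (negPf (tw_neq0 K)).
by rewrite orbF subr_eq0 => /eqP.
Qed.

(** The (i, j) entry of x acting by infinite matrices, read off in the corner
    algebra, which is the line spanned by w. *)
Definition entry (i j : nat) x : K := vac (S' ^+ i * x * S ^+ j).

Lemma entryE i j x : w * S' ^+ i * x * S ^+ j * w = entry i j x *: w.
Proof. by rewrite -vacE !mulrA. Qed.

Fact entry_is_linear i j : scalar (entry i j).
Proof.
move=> c x y; apply: scale_w_inj.
rewrite -entryE [RHS]scalerDl -[X in _ = X + _]scalerA -!entryE.
by rewrite mulrDr !mulrDl -scalerAr -!scalerAl.
Qed.

HB.instance Definition _ i j :=
  GRing.isLinear.Build K T K _ (entry i j) (entry_is_linear i j).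

Lemma entry_mono i j a b :
  entry i j (mono K a b) = [&& a <= i, b <= j & i - a == j - b]%N%:R.
Proof.
apply: scale_w_inj; rewrite -entryE scaler_nat /mono !mulrA -(mulrA w).
rewrite coshift_shiftX; case: ltngtP => [lt_ia|lt_ai|->].
- by rewrite w_shiftX subn_eq0 leqNgt lt_ia !mul0r.
- case: (leqP b j) => [le_bj|lt_jb] /=; last first.
    rewrite -!mulrA (mulrA (S' ^+ b)) coshift_shiftX leqNgt lt_jb /=.
    by rewrite coshiftX_w subn_eq0 leqNgt lt_jb !mulr0.
  by rewrite -(mulrA _ (S' ^+ b)) coshift_shiftX le_bj w_mid.
rewrite subnn expr0 mulr1 /=; case: (leqP b j) => [le_bj|lt_jb].
  rewrite -(mulrA w) coshift_shiftX le_bj w_shiftX mulrnAl wwE.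
  by rewrite [in RHS]eq_sym.
rewrite -!mulrA (mulrA (S' ^+ b)) coshift_shiftX leqNgt lt_jb /=.
by rewrite coshiftX_w subn_eq0 leqNgt lt_jb mulr0.
Qed.

Lemma entry_munit i j k l : entry i j (E k l) = ((i == k) && (j == l))%:R.
Proof.
apply: scale_w_inj; rewrite -entryE scaler_nat munit.unlock !mulrA w_mid.
by rewrite !mulrnAl w_mid (eq_sym l); case: (i == k); case: (j == l).
Qed.

Lemma toepF_munit i j : toepF K (E i j).
Proof. by apply: span_gen; exists i.+1, j.+1; rewrite FijE. Qed.

Lemma toepF_ind (P : set T) :
  subspace P -> (forall i j, P (E i j)) -> toepF K `<=` P.
Proof.
move=> Ps PE; apply: span_ind => // _ [[|i] [[|j] [// _ _ ->]]].
by rewrite FijE.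
Qed.

Lemma toepFn_munit (i j : nat) n : i%:Z - j%:Z = n -> toepFn K n (E i j).
Proof.
move=> ijn; apply: span_gen; exists i.+1, j.+1; rewrite FijE; split=> //; lia.
Qed.

Lemma toepFn_ind n (P : set T) :
  subspace P -> (forall i j : nat, i%:Z - j%:Z = n -> P (E i j)) ->
  toepFn K n `<=` P.
Proof.
move=> Ps PE; apply: span_ind => // _ [[|i] [[|j] [// _ _ ijn ->]]].
by rewrite FijE; apply: PE; lia.
Qed.

Lemma subspaceF : subspace (toepF K). Proof. exact: span_subspace. Qed.

Lemma subspaceFn n : subspace (toepFn K n). Proof. exact: span_subspace. Qed.

Lemma toepFn_sub n : toepFn K n `<=` toepF K.
Proof.
by apply: toepFn_ind => [|i j _]; [exact: subspaceF | exact: toepF_munit].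
Qed.

Lemma mono_munit_mul a b i j :
  mono K a b * E i j = E (a + (i - b)) j *+ (b <= i).
Proof.
rewrite /mono ?munit.unlock !mulrA -(mulrA _ (S' ^+ b)) coshift_shiftX.
case: leqP => bi; first by rewrite -exprD.
by rewrite -(mulrA _ (S' ^+ _)) coshiftX_w subn_eq0 leqNgt bi !mulr0 mul0r.
Qed.

Lemma munit_mono_mul a b i j :
  E i j * mono K a b = E i (b + (j - a)) *+ (a <= j).
Proof.
rewrite /mono ?munit.unlock !mulrA -(mulrA _ (S' ^+ j)) coshift_shiftX.
case: leqP => [ja|aj]; last first.
  by rewrite ltnW // -(mulrA _ (S' ^+ _)) -exprD addnC.
rewrite -(mulrA _ w) w_shiftX subn_eq0; case: (leqP a j) => aj.
  by rewrite (eqP (_ : j - a == 0)%N) ?addn0 // subn_eq0.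
by rewrite mulr0 mul0r.
Qed.

Lemma toepF_mull x y : toepF K y -> toepF K (x * y).
Proof.
move=> Fy; move: x; apply: mono_ind => [|a b].
  exact: subspace_mulr subspaceF.
move: y Fy; apply: toepF_ind => [|i j].
  exact: subspace_mull subspaceF.
rewrite /= mono_munit_mul; case: (b <= i)%N; first exact: toepF_munit.
by case: subspaceF.
Qed.

(** Requiring the expansion for all large M lets two elements be expanded over
    the same range. *)
Lemma toepF_finite x : toepF K x ->
  exists N, forall M, (N <= M)%N ->
    x = \sum_(i < M) \sum_(j < M) entry i j x *: E i j.
Proof.
move: x; apply: toepF_ind => [|k l].
  split=> [|c x y [N1 xE] [N2 yE]] /=.
    exists 0%N => M _; rewrite big1 // => i _; rewrite big1 // => j _.
    by rewrite linear0 scale0r.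
  exists (maxn N1 N2) => M; rewrite geq_max => /andP[/xE xM /yE yM].
  rewrite {1}xM {1}yM scaler_sumr -big_split /=; apply: eq_bigr => i _.
  rewrite scaler_sumr -big_split /=; apply: eq_bigr => j _.
  by rewrite linearP /= scalerDl scalerA.
exists (maxn k l).+1 => M; rewrite gtn_max => /andP[kM lM].
rewrite (bigD1 (Ordinal kM)) //= (bigD1 (Ordinal lM)) //=.
rewrite entry_munit !eqxx scale1r.
rewrite big1 => [|j neq_j]; last first.
  rewrite entry_munit eqxx -val_eqE /= in neq_j *.
  by rewrite (negPf neq_j) scale0r.
rewrite big1 ?addr0 // => i neq_i; rewrite big1 // => j _.
by rewrite entry_munit -val_eqE /= in neq_i *; rewrite (negPf neq_i) scale0r.
Qed.

Lemma toepF_entry0 x : toepF K x -> (forall i j, entry i j x = 0) -> x = 0.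
Proof.
move=> /toepF_finite[N /(_ N (leqnn N)) xE] x0.
by rewrite xE big1 // => i _; rewrite big1 // => j _; rewrite x0 scale0r.
Qed.

Lemma laurent_tX z n : laurent_t K z ^+ n = laurent_t K (z *+ n).
Proof.
elim: n => [|n IHn]; first by rewrite mulr0n expr0 laurent_t0.
by rewrite exprS IHn mulrS laurent_tD.
Qed.

Lemma rho_shift : rho K S = laurent_t K 1.
Proof. by rewrite rmorphD /= !rho_gen addr0. Qed.

Lemma rho_coshift : rho K S' = laurent_t K (-1).
Proof. by rewrite rmorphD /= !rho_gen addr0. Qed.

Lemma rho_mono a b : rho K (mono K a b) = laurent_t K (a%:Z - b%:Z).
Proof.
rewrite rmorphM !rmorphXn /= rho_shift rho_coshift !laurent_tX -laurent_tD.
by rewrite mulNrn !pmulrn !intz.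
Qed.

Lemma toepF_rho0 x : toepF K x -> rho K x = 0.
Proof.
move: x; apply: toepF_ind => [|i j]; first exact: (subspace_ker (rho K)).
rewrite munit_mono /= linearB /= !rho_mono; apply/eqP.
by rewrite subr_eq0; apply/eqP; congr laurent_t; lia.
Qed.

Definition lcoef (n : int) (g : laurent K) : K := mcoeff n g.

Fact lcoef_is_linear n : scalar (lcoef n).
Proof. by move=> c g h; rewrite /lcoef (mcoeffD n (c *: g)) mcoeffZ. Qed.

HB.instance Definition _ n :=
  GRing.isLinear.Build K (laurent K) K _ (lcoef n) (lcoef_is_linear n).

Lemma lcoef_t m n : lcoef m (laurent_t K n) = (n == m)%:R.
Proof. by rewrite /lcoef /laurent_t mcoeffU. Qed.

(** An element is a Toeplitz matrix with symbol rho x up to finitely many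
    entries, as S^a S'^b agrees with a pure shift from index max a b on. *)
Lemma entry_eventually x : exists N, forall i j, (N <= i)%N -> (N <= j)%N ->
  entry i j x = lcoef (i%:Z - j%:Z) (rho K x).
Proof.
apply: (mono_ind (P := [set x | exists N, forall i j,
  (N <= i)%N -> (N <= j)%N ->
  entry i j x = lcoef (i%:Z - j%:Z) (rho K x)])) => [|a b] /=.
  split=> [|c y z [N1 yE] [N2 zE]] /=.
    by exists 0%N => i j _ _; rewrite !linear0.
  exists (maxn N1 N2) => i j; rewrite !geq_max => /andP[i1 i2] /andP[j1 j2].
  by rewrite !linearP /= yE // zE.
exists (maxn a b) => i j; rewrite !geq_max => /andP[ai bi] /andP[aj bj].
rewrite entry_mono rho_mono lcoef_t ai bj /=; congr (_%:R).
by congr nat_of_bool; apply/eqP/eqP; lia.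
Qed.

(** The lift of t^n along rho appearing in the description of components. *)
Definition tpow (n : int) : T :=
  match n with Posz k => te K ^+ k | Negz k => tes K ^+ k.+1 end.

Lemma rho_tpow n : rho K (tpow n) = laurent_t K n.
Proof.
case: n => k; rewrite /= rmorphXn /= rho_gen laurent_tX.
  by rewrite pmulrn intz.
by rewrite mulNrn pmulrn intz NegzE.
Qed.

Lemma teX n : te K ^+ n.+1 = mono K n.+1 0 - E n.+1 0.
Proof.
rewrite /mono munit.unlock !mulr1; elim: n => [|n IHn].
  by rewrite !expr1 teE.
have XS : (S ^+ n.+1 - S ^+ n.+1 * w) * S = S ^+ n.+2.
  by rewrite mulrBl -mulrA w_shift mulr0 subr0 -exprSr.
by rewrite exprSr IHn teE mulrBr mulrA XS.
Qed.

Lemma tesX n : tes K ^+ n.+1 = mono K 0 n.+1 - E 0 n.+1.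
Proof.
rewrite /mono munit.unlock !mul1r; elim: n => [|n IHn].
  by rewrite !expr1 tesE.
have SX : S' * (S' ^+ n.+1 - w * S' ^+ n.+1) = S' ^+ n.+2.
  by rewrite mulrBr mulrA coshift_w mul0r subr0 -exprS.
by rewrite exprS IHn tesE mulrBl -mulrA SX.
Qed.

Lemma mono_decomp a b n : a%:Z - b%:Z = n ->
  toepFn K n (mono K a b - tpow n).
Proof.
move=> <-; elim: b a => [|b IHb] a.
  rewrite subr0; case: a => [|a] /=; last first.
    by rewrite teX opprB addrC subrK; apply: toepFn_munit; lia.
  by rewrite /mono !expr0 mulr1 subrr; case: (subspaceFn 0).
case: a => [|a].
  have -> : 0%:Z - b.+1%:Z = Negz b by lia.
  by rewrite /= tesX opprB addrC subrK; apply: toepFn_munit; lia.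
have -> : a.+1%:Z - b.+1%:Z = a%:Z - b%:Z by lia.
have -> : mono K a.+1 b.+1 = mono K a b - E a b by rewrite munit_mono subKr.
rewrite addrAC; apply: subspaceB (IHb a) _; first exact: subspaceFn.
exact: toepFn_munit.
Qed.

(** A linear section of rho. *)
Definition laurent_lift (g : laurent K) : T :=
  mmap (in_alg T) tpow (g : {malg K[int]}).

Fact laurent_lift_is_linear : linear laurent_lift.
Proof.
move=> c g h; rewrite /laurent_lift.
have -> : (c *: g + h : laurent K) = c *: (g : {malg K[int]}) + h by [].
rewrite raddfD /=; congr (_ + _).
rewrite (mmapEw (msuppZ_le c _)) mmapE scaler_sumr.
by apply: eq_bigr => m _; rewrite mcoeffZ /= !mulr_algl scalerA.
Qed.

HB.instance Definition _ :=
  GRing.isLinear.Build K (laurent K) T _ laurent_lift laurent_lift_is_linear.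

Lemma laurent_lift_t n : laurent_lift (laurent_t K n) = tpow n.
Proof. by rewrite /laurent_lift mmapU /= scale1r mul1r. Qed.

Lemma toepF_sub_lift x : toepF K (x - laurent_lift (rho K x)).
Proof.
apply: (mono_ind (P := [set x | toepF K (x - laurent_lift (rho K x))]))
  => [|a b] /=.
  split=> [|c y z Fy Fz] /=; first by rewrite !linear0 addr0; case: subspaceF.
  rewrite !linearP /= addrACA -scalerDr.
  exact: (proj2 subspaceF).
by rewrite rho_mono laurent_lift_t; apply: toepFn_sub (mono_decomp _).
Qed.

Lemma rho_eq0 x : rho K x = 0 <-> toepF K x.
Proof.
split; last exact: toepF_rho0.
by move=> x0; have := toepF_sub_lift x; rewrite x0 linear0 subr0.
Qed.

(** The Laurent polynomial rho x is read off far down each diagonal, so it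
    vanishes and x lies in F, where the entries are coordinates. *)
Lemma entry_inj x : (forall i j, entry i j x = 0) -> x = 0.
Proof.
move=> x0; apply: toepF_entry0 (x0); apply/rho_eq0/malgP => n.
rewrite mcoeff0; have [N NE] := entry_eventually x; pose k := absz n.
(* A position beyond (N, N) on the diagonal i - j = n. *)
have := NE (N + k)%N (if (0 <= n)%R then N else N + k + k)%N.
rewrite x0 /lcoef.
have -> : (N + k)%:Z - (if (0 <= n)%R then N else N + k + k)%N%:Z = n.
  by rewrite /k; case: ifP; lia.
by move=> <- //; [exact: leq_addr | case: ifP => _; lia].
Qed.

End Coefficients.

(** * Homogeneous components and the trace *)
Section Grading.
Context (K : fieldType).
Local Notation T := (toeplitz K).
Local Notation w := (tw K).
Local Notation E := (@munit K).
Local Notation C := (toep_comp K).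
Implicit Types (x y : T).

Lemma toep_comp_ind n (P : set T) :
  subspace P -> (forall a b : nat, a%:Z - b%:Z = n -> P (mono K a b)) ->
  C n `<=` P.
Proof.
move=> Ps Pm; rewrite toep_compE; apply: span_ind => // _ [a [b [abn ->]]].
exact: Pm.
Qed.

Lemma toep_comp_mono a b n : a%:Z - b%:Z = n -> C n (mono K a b).
Proof. by rewrite toep_compE; exact: homog_mono. Qed.

Lemma subspaceC n : subspace (C n). Proof. exact: span_subspace. Qed.

Lemma toepFn_comp n : toepFn K n `<=` C n.
Proof.
apply: toepFn_ind => [|i j ijn]; first exact: subspaceC.
rewrite munit_mono; apply: subspaceB (subspaceC n) _ _;
  apply: toep_comp_mono; lia.
Qed.

Lemma natB_surj n : exists a b : nat, a%:Z - b%:Z = n.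
Proof.
case: n => k; first by exists k, 0%N; rewrite subr0.
by exists 0%N, k.+1; rewrite sub0r.
Qed.

Lemma tpow_comp n : C n (tpow K n).
Proof.
have [a [b abn]] := natB_surj n.
rewrite -[tpow K n](subKr (mono K a b)); apply: subspaceB (subspaceC n) _ _.
  exact: toep_comp_mono.
by apply: toepFn_comp; exact: mono_decomp.
Qed.

Lemma entry_comp n x i j : C n x -> i%:Z - j%:Z != n -> entry i j x = 0.
Proof.
move=> Cx ijn; move: x Cx; apply: toep_comp_ind => [|a b abn].
  split=> [|c y z /= y0 z0]; first exact: linear0.
  by rewrite linearP /= y0 z0 mulr0 addr0.
rewrite /= entry_mono; case: and3P => //= -[ai bj /eqP abij].
by case/eqP: ijn; lia.
Qed.

(** Components of different degrees are supported on different diagonals. *)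
Lemma toep_comp_independent : independent C.
Proof.
move=> s a us Ca sum0 n ns; apply: entry_inj => i j.
case: (eqVneq (i%:Z - j%:Z) n) => [ijn|]; last exact: entry_comp (Ca n).
have := congr1 (entry i j) sum0; rewrite linear0 linear_sum /= => <-.
rewrite (bigD1_seq n) //= big1 ?addr0 // => m neq_mn.
by apply: entry_comp (Ca m) _; rewrite ijn eq_sym.
Qed.

Lemma toep_compP n : dirsum2 (C n) (line (tpow K n)) (toepFn K n).
Proof.
split.
  apply/seteqP; split=> [|_ [_ [c _ <-] [y Fy <-]]].
    apply: toep_comp_ind => [|a b abn].
      exact: subspace_sumset (subspace_line _) (subspaceFn K n).
    exists (tpow K n); first exact: line_gen.
    exists (mono K a b - tpow K n); first exact: mono_decomp.
    by rewrite addrC subrK.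
  by apply: (proj2 (subspaceC n)); [exact: tpow_comp | exact: toepFn_comp].
apply/seteqP; split=> [x [[c _ <-] /toepFn_sub/toepF_rho0]|_ ->].
  rewrite linearZ /= rho_tpow => /(congr1 (lcoef n)).
  rewrite linearZ /= lcoef_t eqxx linear0 mulr1 => ->.
  by rewrite /= scale0r.
by split; [case: (subspace_line (tpow K n)) | case: (subspaceFn K n)].
Qed.

Lemma toep_compF n x : C n x -> toepF K x -> toepFn K n x.
Proof.
rewrite (proj1 (toep_compP n)) => -[_ [c _ <-] [y Fy <-]] /toepF_rho0.
rewrite linearD linearZ /= rho_tpow (toepF_rho0 (toepFn_sub Fy)) addr0.
move=> /(congr1 (lcoef n)); rewrite linearZ /= lcoef_t eqxx linear0 mulr1 => ->.
by rewrite scale0r add0r.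
Qed.

Lemma toep_dirsum : dirsum [set: T] C.
Proof.
apply: dirsumI => //; [exact: subspaceC | | exact: toep_comp_independent].
apply/seteqP; split=> // x _.
apply: (mono_ind (span_subspace _)) => a b.
by apply: span_gen; exists (a%:Z - b%:Z); exact: toep_comp_mono.
Qed.

Lemma toepF_dirsum : dirsum (toepF K) (toepFn K).
Proof.
apply: dirsumI; first exact: subspaceFn.
  apply/seteqP; split.
    apply: toepF_ind => [|i j]; first exact: span_subspace.
    by apply: span_gen; exists (i%:Z - j%:Z); exact: toepFn_munit.
  by apply: span_ind => [|x [n /toepFn_sub]]; first exact: subspaceF.
move=> s a us Fa; apply: toep_comp_independent us _ => n.
exact: toepFn_comp (Fa n).
Qed.

Local Notation s := (toep_s K).

Lemma subspace_s : subspace s. Proof. exact: span_subspace. Qed.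

Lemma toep_s_lie x y : toepF K x -> toepF K y -> s (lie x y).
Proof. by move=> Fx Fy; apply: span_gen; exists x => //; exists y. Qed.

(** For i <> j the unit is [E i j, E j j]; on the diagonal the difference is
    [E i 0, E 0 i]. *)
Lemma toep_s_munit i j : s (E i j - w *+ (i == j)).
Proof.
have EF := @toepF_munit K.
case: eqP => [<-|/eqP ij].
  have := toep_s_lie (EF i 0%N) (EF 0%N i).
  by rewrite /lie !munitM !eqxx munit00.
have := toep_s_lie (EF i j) (EF j j).
by rewrite /lie !munitM eqxx (eq_sym j) (negPf ij) !subr0.
Qed.

Lemma toep_sF : s `<=` toepF K.
Proof.
apply: span_ind => [|_ [x Fx [y Fy <-]]]; first exact: subspaceF.
apply: subspaceB (subspaceF K) _ _; exact: toepF_mull.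
Qed.

(** Used with P = s, this says F = s + K w.  The extra generality allows s to be
    compared with other subspaces containing the same generators. *)
Lemma toepF_mod_s (P : set T) : subspace P ->
  (forall i j, P (E i j - w *+ (i == j))) ->
  forall x, toepF K x -> exists c, P (x - c *: w).
Proof.
move=> [P0 PD] PE; apply: toepF_ind => [|i j]; last first.
  by exists (i == j)%:R; rewrite scaler_nat.
split=> [|a x y [b Pb] [c Pc]]; first by exists 0; rewrite scale0r subr0.
exists (a * b + c).
by rewrite scalerDl opprD addrACA -scalerA -scalerBr; apply: PD.
Qed.

(** On F the partial sums of the diagonal are eventually the trace; the
    condition makes sense on the whole algebra and defines a subspace. *)
Definition eventually_traceless : set T :=
  [set x | exists N, forall M, (N <= M)%N -> \sum_(i < M) entry i i x = 0].

Lemma subspace_traceless : subspace eventually_traceless.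
Proof.
split=> [|c x y [N1 xE] [N2 yE]].
  by exists 0%N => M _; rewrite big1 // => i _; rewrite linear0.
exists (maxn N1 N2) => M; rewrite geq_max => /andP[/xE xM /yE yM].
under eq_bigr do rewrite linearP.
by rewrite big_split /= -mulr_sumr xM yM mulr0 addr0.
Qed.

Lemma trace_munit M i j : (i < M)%N ->
  \sum_(k < M) entry k k (E i j) = (i == j)%:R.
Proof.
move=> iM; rewrite (bigD1 (Ordinal iM)) //= entry_munit eqxx /= big1 ?addr0 //.
move=> k neq_ki; rewrite entry_munit.
by rewrite -val_eqE /= in neq_ki; rewrite (negPf neq_ki).
Qed.

Lemma toep_s_traceless : s `<=` eventually_traceless.
Proof.
have [t0 tD] := subspace_traceless.
apply: span_ind => // _ [x Fx [y Fy <-]].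
move: x Fx; apply: toepF_ind => [|i j].
  exact: subspace_liel subspace_traceless.
move: y Fy; apply: toepF_ind => [|k l].
  exact: subspace_lier subspace_traceless.
exists (maxn i k).+1 => M; rewrite gtn_max => /andP[iM kM].
rewrite /lie !munitM.
under eq_bigr do rewrite linearB !linearMn /=.
rewrite sumrB !sumrMnl.
rewrite !trace_munit // (eq_sym l) (eq_sym k).
by case: (i == l); case: (j == k); rewrite /= ?mulr1n ?mulr0n subrr.
Qed.

Lemma tw_notin_s : ~ s w.
Proof.
move=> /toep_s_traceless[N /(_ N.+1 (leqnSn N))].
by rewrite -munit00 trace_munit //= => /eqP; rewrite oner_eq0.
Qed.

Lemma scale_tw_s c : s (c *: w) -> c = 0.
Proof.
move=> scw; apply/eqP/negPn/negP => c0; apply: tw_notin_s.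
by rewrite -[w](scalerK c0); apply: subspaceZ subspace_s _.
Qed.

Lemma toep_gradedI S : subspace S ->
  S `<=` span [set x | S x /\ exists n, C n x] -> graded_subspace C S.
Proof. exact: graded_subspaceI toep_comp_independent subspaceC. Qed.

(** Reducing modulo w with homogeneous generators of s leaves a multiple of w
    that lies in s, hence is 0. *)
Lemma toep_s_graded : graded_subspace C s.
Proof.
apply: toep_gradedI; first exact: subspace_s.
move=> x sx; set H := span _.
have Hs : subspace H by exact: span_subspace.
have [|c Hc] := toepF_mod_s (P := H) Hs _ (toep_sF sx).
  move=> i j; apply: span_gen; split; first exact: toep_s_munit.
  exists (i%:Z - j%:Z); apply: subspaceB (subspaceC _) _ _.
    by apply: toepFn_comp; exact: toepFn_munit.
  case: eqP => [->|_]; last by case: (subspaceC (i%:Z - j%:Z)).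
  by rewrite subrr -munit00; apply: toepFn_comp; exact: toepFn_munit.
suff c0 : c = 0 by rewrite c0 scale0r subr0 in Hc.
apply: scale_tw_s; rewrite -[_ *: _](subKr x); apply: subspaceB subspace_s sx _.
by move: Hc; apply: span_ind => [|y []//]; exact: subspace_s.
Qed.

Lemma toep_s_comp n : n != 0 -> s `&` C n = toepFn K n.
Proof.
move=> n0; apply/seteqP; split=> [x [/toep_sF Fx Cx]|]; first exact: toep_compF.
move=> x Fx; split; last exact: toepFn_comp.
move: x Fx; apply: toepFn_ind => [|i j ijn]; first exact: subspace_s.
have ij : (i == j) = false by apply/eqP => ij; case/eqP: n0; lia.
by have := toep_s_munit i j; rewrite ij subr0.
Qed.

Lemma toep_s_comp0 : s `&` C 0 = toep_s0 K.
Proof.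
apply/seteqP; split=> [x [sx Cx]|_ [N [a [sa0 ->]]]].
  have [N1 trx] := toep_s_traceless sx.
  have [N2 xE] := toepF_finite (toep_sF sx).
  (* The units F_ii are numbered from 1. *)
  pose M := maxn N1 N2; exists M.+1, (fun i => entry i.-1 i.-1 x).
  rewrite !big_add1 /= !big_mkord; split; first by apply: trx; exact: leq_maxl.
  rewrite {1}(xE M) ?leq_maxr //; apply: eq_bigr => i _.
  rewrite FijE (bigD1 i) //= big1 ?addr0 // => j neq_ji.
  rewrite (entry_comp Cx) ?scale0r // subr_eq0 eq_sym.
  by rewrite -val_eqE /= in neq_ji.
case: N sa0 => [|N] sa0.
  by rewrite big_geq //; split; [case: subspace_s | case: (subspaceC 0)].
rewrite !big_add1 /= !big_mkord in sa0 *.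
split; last first.
  apply: subspace_sum => [|i _]; first exact: subspaceC.
  apply: subspaceZ (subspaceC 0) _; rewrite FijE.
  by apply: toepFn_comp; apply: toepFn_munit; rewrite subrr.
have -> : \sum_(i < N) a i.+1 *: Fij K i.+1 i.+1 =
    \sum_(i < N) a i.+1 *: (E i i - w *+ (i == i :> nat)).
  under [RHS]eq_bigr do rewrite eqxx scalerBr.
  rewrite sumrB -scaler_suml sa0 scale0r subr0.
  by apply: eq_bigr => i _; rewrite FijE.
apply: subspace_sum => [|i _]; first exact: subspace_s.
by apply: subspaceZ subspace_s _; exact: toep_s_munit.
Qed.

End Grading.

(** * Lie ideals *)
Section LieIdeals.
Context (K : fieldType).
Local Notation T := (toeplitz K).
Local Notation w := (tw K).
Local Notation E := (@munit K).
Local Notation C := (toep_comp K).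
Local Notation s := (toep_s K).
Local Notation F := (toepF K).
Local Notation ss := (subspace_s K).
Local Notation sF := (subspaceF K).
Implicit Types (a x y : T) (L : set T).

Lemma lie_toepF a x : F (lie a x).
Proof.
apply/rho_eq0; rewrite linearB /= !rmorphM /= mulrC; exact: subrr.
Qed.

(** Both S^p S'^q E i j and E i j S^p S'^q are matrix units or 0, and they have
    the same trace. *)
Lemma lie_toepF_s a x : F x -> s (lie a x).
Proof.
move=> Fx; apply: (mono_ind (subspace_liel x ss)) => p q /=.
move: x Fx; apply: toepF_ind => [|i j]; first exact: subspace_lier ss.
rewrite /lie mono_munit_mul munit_mono_mul.
have sE k l (b : bool) : s (E k l *+ b - w *+ (b && (k == l))).
  case: b; first exact: toep_s_munit.
  by rewrite subrr; case: ss.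
have -> : E (p + (i - q)) j *+ (q <= i)%N - E i (q + (j - p)) *+ (p <= j)%N =
  (E (p + (i - q)) j *+ (q <= i)%N - w *+ ((q <= i)%N && (p + (i - q) == j)%N))
  - (E i (q + (j - p)) *+ (p <= j)%N
     - w *+ ((p <= j)%N && (i == q + (j - p))%N)).
  have -> : (q <= i)%N && (p + (i - q) == j)%N =
      (p <= j)%N && (i == q + (j - p))%N.
    by apply/andP/andP => -[h1 /eqP h2]; split; [|apply/eqP| |apply/eqP]; lia.
  by rewrite opprB addrA subrK.
by apply: subspaceB ss _ _; apply: sE.
Qed.

(** 1 - S^k S'^k is the projection onto the first k coordinates, of trace k. *)
Lemma mono_diag_mod_s k : s (1 - mono K k k - w *+ k).
Proof.
elim: k => [|k IHk].
  by rewrite /mono !expr0 mulr1 subrr subr0; case: ss.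
have -> : 1 - mono K k.+1 k.+1 - w *+ k.+1 =
    (1 - mono K k k - w *+ k) + (E k k - w *+ (k == k)).
  by rewrite munit_mono eqxx mulr1n addrACA subrKA -opprD -mulrSr.
by apply: subspaceD ss IHk _; exact: toep_s_munit.
Qed.

Lemma lie_modFr a x y z : F (x - y) -> s (lie a y - z) -> s (lie a x - z).
Proof.
move=> Fxy sy; rewrite -(subrK y x) lieDr -addrA.
by apply: subspaceD ss _ sy; exact: lie_toepF_s.
Qed.

Lemma lie_modFl a b x z : F (a - b) -> s (lie b x - z) -> s (lie a x - z).
Proof.
move=> Fab sb; rewrite lieN -(subrK b a) lieDr opprD -(lieN b) -addrA.
by apply: subspaceD ss _ sb; apply: subspaceN ss _; exact: lie_toepF_s.
Qed.

Lemma mono_modF (a b c d : nat) : a%:Z - b%:Z = c%:Z - d%:Z ->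
  F (mono K a b - mono K c d).
Proof.
move=> ab; rewrite -(subrKA (tpow K (a%:Z - b%:Z))).
apply: subspaceD sF _ _; first by apply: toepFn_sub; exact: mono_decomp.
rewrite -opprB; apply: subspaceN sF _; rewrite ab.
by apply: toepFn_sub; exact: mono_decomp.
Qed.

(** Modulo F, S^p S'^q and e^n are pure powers of the shift and its one-sided
    inverse, in opposite degrees.  Their commutator is plus or minus a
    projection of rank |n|, and its trace is n. *)
Lemma lie_tpow n p q : p%:Z - q%:Z = - n ->
  s (lie (mono K p q) (tpow K n) - n%:~R *: w).
Proof.
move=> pqn.
have key (a b c d : nat) : p%:Z - q%:Z = a%:Z - b%:Z -> c%:Z - d%:Z = n ->
    s (lie (mono K a b) (mono K c d) - n%:~R *: w) ->
    s (lie (mono K p q) (tpow K n) - n%:~R *: w).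
  move=> pq cd sl; apply: lie_modFl (mono_modF pq) _.
  apply: lie_modFr sl; rewrite -opprB; apply: subspaceN sF _.
  by apply: toepFn_sub; exact: mono_decomp.
case: n pqn key => k pqk key.
  apply: (key 0%N k k 0%N); [lia | lia |].
  rewrite /lie monoM leqnn subnn addn0 -pmulrn scaler_nat.
  have -> : mono K 0 0 = 1 by rewrite /mono mulr1.
  rewrite monoM leqnn subnn addn0; exact: mono_diag_mod_s.
apply: (key k.+1 0%N 0%N k.+1); [lia | lia |].
rewrite /lie !monoM !leqnn !subnn ?addn0.
have -> : mono K 0 0 = 1 by rewrite /mono mulr1.
rewrite NegzE mulrNz scaleNr opprK -pmulrn scaler_nat -opprB.
rewrite -[w *+ _]opprK -opprD; apply: subspaceN ss _; exact: mono_diag_mod_s.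
Qed.

(** Brackets in nonzero degree lie in F_m for some m <> 0, hence in s; in degree
    zero the trace n vanishes in K. *)
Lemma lie_tpow_s a n : n%:~R = 0 :> K -> s (lie a (tpow K n)).
Proof.
move=> n0; apply: (mono_ind (subspace_liel _ ss)) => p q /=.
case: (eqVneq (p%:Z - q%:Z) (- n)) => [pqn|pqn].
  by have := lie_tpow pqn; rewrite n0 scale0r subr0.
have hc m x y : C m x -> C n y -> C (m + n) (lie x y).
  move=> Cx Cy; apply: subspaceB (subspaceC K _) _ _; first exact: toep_compM.
  by rewrite addrC; exact: toep_compM.
have [] : (s `&` C (p%:Z - q%:Z + n)) (lie (mono K p q) (tpow K n)) => //.
rewrite toep_s_comp; last by rewrite addr_eq0.
apply: toep_compF (lie_toepF _ _).
by apply: hc; [exact: toep_comp_mono | exact: tpow_comp].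
Qed.

(** Commutation with the units forces the matrix of x to be c times the
    identity. *)
Lemma commuting_scalar x : (forall i j, lie (E i j) x = 0) -> line 1 x.
Proof.
move=> cx.
have xE i j : entry i j x *: w = (x * w) *+ (i == j).
  have -> : entry i j x *: w = E 0 i * x * E j 0.
    by rewrite -entryE !munit.unlock mulr1 mul1r !mulrA.
  have /eqP := cx 0%N i; rewrite subr_eq0 => /eqP->.
  by rewrite -mulrA munitM munit00 mulrnAr.
exists (entry 0 0 x) => //; apply/eqP; rewrite eq_sym -subr_eq0; apply/eqP.
apply: entry_inj => i j; rewrite linearB linearZ /=; apply/eqP.
rewrite subr_eq0.
apply/eqP; apply: (@scale_w_inj K); rewrite xE -scalerA.
have -> : 1 = mono K 0 0 by rewrite /mono mulr1.
rewrite entry_mono /= !subn0 scaler_nat.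
have := xE 0%N 0%N; rewrite eqxx mulr1n => <-.
by rewrite scalerMnr.
Qed.

Lemma lie_ideal_r L a x : lie_ideal L -> L x -> L (lie x a).
Proof.
by move=> [Ls LL] Lx; rewrite lieN; apply: subspaceN Ls _; apply: LL.
Qed.

(** For k beyond the support of y and l <> k, the double bracket
    [[E k i, y], E j l] reduces to E k i y E j l, a multiple of E k l by the
    (i, j) entry of y. *)
Lemma munit_in_lie_ideal L y : lie_ideal L -> L y -> F y -> y <> 0 ->
  exists N, forall k l, (N <= k)%N -> k != l -> L (E k l).
Proof.
move=> LL Ly Fy y0.
have [N /(_ N (leqnn N)) yE] := toepF_finite Fy.
have [i [j yij]] : exists i j, entry i j y != 0.
  apply/not_existsP => h; apply: y0; apply: entry_inj => i j.
  by apply/eqP/negPn/negP => yij; apply: (h i); exists j.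
exists N => k l Nk neq_kl.
have yE0 i' : y * E k i' = 0.
  rewrite yE mulr_suml big1 // => a _; rewrite mulr_suml big1 // => b _.
  by rewrite -scalerAl munitM ltn_eqF ?scaler0 // (leq_trans (ltn_ord b)).
have kyl : E k i * y * E j l = entry i j y *: E k l.
  have -> : E k i * y * E j l = E k 0 * (E 0 i * y * E j 0) * E 0 l.
    by rewrite !mulrA munitM eqxx -(mulrA _ (E j 0)) munitM eqxx.
  have -> : E 0 i * y * E j 0 = entry i j y *: w.
    by rewrite -entryE !munit.unlock mulr1 mul1r !mulrA.
  by rewrite -scalerAr -scalerAl -munit00 !munitM.
have : L (lie (lie (E k i) y) (E j l)).
  by apply: lie_ideal_r => //; apply: (proj2 LL).
rewrite /lie yE0 subr0 kyl mulrA munitM eq_sym (negPf neq_kl) mul0r subr0.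
move=> Lkl; rewrite -[E k l](scalerK yij).
by apply: subspaceZ (proj1 LL) _.
Qed.

(** Bracketing a non-scalar x with a suitable matrix unit gives a nonzero finite
    matrix in L.  Once L contains the units in some far row, brackets spread
    them to all off-diagonal units and to the traceless diagonal. *)
Lemma s_sub_lie_ideal L x : lie_ideal L -> L x -> ~ line 1 x -> s `<=` L.
Proof.
move=> LL Lx x1; have [Ls Lie] := LL.
have [i0 [j0 cx0]] : exists i j, lie (E i j) x <> 0.
  apply/not_existsP => h; apply: x1; apply: commuting_scalar => i j.
  by apply/eqP/negPn/negP => /eqP yij; apply: (h i); exists j.
have [N LE] := munit_in_lie_ideal LL (Lie _ _ Lx) (lie_toepF _ _) cx0.
have Eoff i j : i != j -> L (E i j).
  move=> neq_ij; pose k := (N + i + j).+1.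
  have Lkj : L (E k j) by apply: LE; rewrite /k; lia.
  have := Lie (E i k) _ Lkj.
  by rewrite /lie !munitM eqxx (eq_sym j) (negPf neq_ij) subr0.
have sLs : subspace (s `&` L) by exact: subspaceI ss Ls.
move=> y sy.
have [|c [syc Lyc]] := toepF_mod_s sLs _ (toep_sF sy).
  move=> i j; split; first exact: toep_s_munit.
  case: (eqVneq i j) => [->|neq_ij]; last by rewrite subr0; exact: Eoff.
  case: (posnP j) => [->|j0']; first by rewrite munit00 subrr; case: Ls.
  have L0j : L (E 0 j) by apply: Eoff; rewrite eq_sym -lt0n.
  by have := Lie (E j 0) _ L0j; rewrite /lie !munitM !eqxx munit00.
suff c0 : c = 0 by rewrite c0 scale0r subr0 in Lyc.
by apply: scale_tw_s; rewrite -[_ *: _](subKr y); apply: subspaceB ss sy syc.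
Qed.

(** If n <> 0 vanishes in K, the characteristic is a prime dividing n, so e^n is
    among the generators of P_K. *)
Lemma tpow_toepP n : n%:~R = 0 :> K -> toepP K (tpow K n).
Proof.
move=> n0; have [k0|k0] := posnP (absz n).
  have -> : n = 0 by lia.
  by apply: span_gen; left; rewrite /= expr0.
have absn0 : (absz n)%:R == 0 :> K.
  case: n n0 {k0} => k; rewrite ?NegzE ?mulrNz ?pmulrn // => /eqP //.
  by rewrite oppr_eq0.
have [l lK] := natf0_pchar k0 absn0.
have /dvdnP[m nE] : (l %| absz n)%N by rewrite (dvdn_pcharf lK).
apply: span_gen; right; exists l, m; split=> //; first by lia.
by case: n {n0 k0 absn0} nE => k /= nE; [left | right]; rewrite -nE.
Qed.

Lemma lie_toepP_s a x : toepP K x -> s (lie a x).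
Proof.
move: x; apply: span_ind => [|x]; first exact: subspace_lier ss.
case=> [->|[l [m [lK m0 xE]]]].
  by rewrite /= -[1]scale1r lie_scalar; case: ss.
have ml0 : (m * l)%:R = 0 :> K.
  by apply/eqP; rewrite -(dvdn_pcharf lK) dvdn_mull.
case: xE => ->.
  by apply: (lie_tpow_s _ (n := (m * l)%N)); rewrite -pmulrn.
have l0 : (0 < m * l)%N by rewrite muln_gt0 m0 /= prime_gt0 //; case/andP: lK.
have -> : tes K ^+ (m * l) = tpow K (- (m * l)%N%:Z).
  by case: (m * l)%N l0.
by apply: lie_tpow_s; rewrite mulrNz -pmulrn ml0 oppr0.
Qed.

Lemma subspaceP : subspace (toepP K). Proof. exact: span_subspace. Qed.

Local Notation Pw := (sumset (toepP K) (line w)).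

Lemma subspacePw : subspace Pw.
Proof. exact: subspace_sumset subspaceP (subspace_line _). Qed.

Lemma toepP_Pw x : toepP K x -> Pw x.
Proof. by apply: sumsetl; case: (subspace_line w). Qed.

Lemma tw_Pw : Pw w.
Proof. by apply: sumsetr; [case: subspaceP | exact: line_gen]. Qed.

Lemma lie_Pw_s a x : Pw x -> s (lie a x).
Proof.
move=> [p Pp [_ [c _ <-] <-]]; rewrite lieDr lieZr.
apply: subspaceD ss (lie_toepP_s _ Pp) _; apply: subspaceZ ss _.
by apply: lie_toepF_s; rewrite -munit00; exact: toepF_munit.
Qed.

Lemma subspace0 : subspace [set 0 : T].
Proof. by split=> [//|a x y -> ->]; rewrite /= scaler0 addr0. Qed.

Lemma tone_comp : C 0 1.
Proof. by have := @tpow_comp K 0. Qed.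

Local Notation graded := (graded_subspace C).

Lemma zero_graded_lie_ideal : lie_ideal [set 0 : T] /\ graded [set 0].
Proof.
split; first by split=> [|a x ->]; [exact: subspace0 | exact: lie0r].
apply: toep_gradedI => [|x ->]; first exact: subspace0.
by case: (span_subspace [set x | [set 0] x /\ exists n, C n x]).
Qed.

Lemma scalars_graded_lie_ideal : lie_ideal (line (1 : T)) /\ graded (line 1).
Proof.
have Ls := subspace_line (1 : T).
split; first by split=> // a _ [c _ <-]; rewrite lie_scalar; case: Ls.
apply: toep_gradedI => // _ [c _ <-]; apply: subspaceZ (span_subspace _) _.
by apply: span_gen; split; [exact: line_gen | exists 0; exact: tone_comp].
Qed.

Lemma sumset_graded_lie_ideal U : graded U -> U `<=` Pw ->
  lie_ideal (sumset s U) /\ graded (sumset s U).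
Proof.
move=> gU UPw; have [Us _] := gU.
have [s0 _] := ss; have [U0 _] := Us.
have sUs := subspace_sumset ss Us.
split; first split=> // a _ [x sx [u Uu <-]].
  apply: (sumsetl U0); rewrite lieDr; apply: subspaceD ss _ _.
    exact: lie_toepF_s (toep_sF sx).
  exact: lie_Pw_s (UPw _ Uu).
apply: toep_gradedI => // _ [x sx [u Uu <-]]; set H := span _.
have Hs : subspace H by exact: span_subspace.
apply: (subspaceD Hs).
  apply: (graded_subspace_ind (toep_s_graded K) Hs) sx => n y sy Cy.
  by apply: span_gen; split; [exact: sumsetl | exists n].
apply: (graded_subspace_ind gU Hs) Uu => n y Uy Cy.
by apply: span_gen; split; [exact: sumsetr | exists n].
Qed.

(** Brackets die under rho, so only the grading needs an argument: modulo F,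
    the section of rho lifts the homogeneous parts of rho x to the preimage. *)
Lemma preimage_graded_lie_ideal (W : set (laurent K)) :
  graded_subspace (laurent_comp K) W ->
  lie_ideal (rho K @^-1` W) /\ graded (rho K @^-1` W).
Proof.
move=> gW; have [Ws _] := gW; have [W0 _] := Ws.
have pWs : subspace (rho K @^-1` W) by exact: (subspace_preim (rho K)).
have FW x : F x -> (rho K @^-1` W) x by move=> /toepF_rho0 rx; rewrite /= rx.
split; first by split=> // a x _; exact: FW (lie_toepF a x).
apply: toep_gradedI => // x Wx; set H := span _.
have Hs : subspace H by exact: span_subspace.
rewrite -(subrK (laurent_lift (rho K x)) x); apply: (subspaceD Hs).
  move: (toepF_sub_lift x); apply: toepF_ind => // i j.
  apply: span_gen; split; first by apply: FW; exact: toepF_munit.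
  by exists (i%:Z - j%:Z); apply: toepFn_comp; exact: toepFn_munit.
apply: (graded_subspace_ind gW (subspace_preim (@laurent_lift K) Hs)) Wx.
move=> n g Wg [c _ gE]; move: Wg.
rewrite -gE /= linearZ /= laurent_lift_t => Wg.
apply: span_gen; split; first by rewrite /= linearZ /= rho_tpow.
by exists n; apply: subspaceZ (subspaceC K n) _; exact: tpow_comp.
Qed.

Lemma laurent_comp_independent : independent (laurent_comp K).
Proof.
move=> r a ur La sum0 n nr.
have aE m : exists c, a m = c *: laurent_t K m.
  by have [c _ <-] := La m; exists c.
have [c aEn] := aE n; rewrite aEn.
have := congr1 (lcoef n) sum0; rewrite linear0 linear_sum /= (bigD1_seq n) //=.
rewrite aEn linearZ /= lcoef_t eqxx mulr1 big1 ?addr0 => [->|m neq_mn].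
  by rewrite scale0r.
by have [d ->] := aE m; rewrite linearZ /= lcoef_t (negPf neq_mn) mulr0.
Qed.

Lemma lie_ideal_preimage L : lie_ideal L -> graded L -> s `<=` L -> L w ->
  exists W : set (laurent K),
    graded_subspace (laurent_comp K) W /\ L = rho K @^-1` W.
Proof.
move=> [Ls _] gL sL Lw.
have FL : F `<=` L.
  move=> x Fx; have [c sx] := toepF_mod_s ss (@toep_s_munit K) Fx.
  rewrite -(subrK (c *: w) x).
  exact: subspaceD Ls (sL _ sx) (subspaceZ _ Ls Lw).
have Ws : subspace (rho K @` L).
  split; first by exists 0; [case: Ls | exact: linear0].
  move=> a _ _ [x Lx <-] [y Ly <-]; exists (a *: x + y); last exact: linearP.
  exact: (proj2 Ls).
exists (rho K @` L); split; last first.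
  apply/seteqP; split=> [x Lx|x [y Ly yx]]; first by exists x.
  rewrite -(subrK y x); apply: subspaceD Ls _ Ly; apply/FL/rho_eq0.
  by rewrite linearB /= yx subrr.
apply: graded_subspaceI => //; first exact: laurent_comp_independent.
  by move=> n; exact: subspace_line.
move=> _ [x Lx <-].
apply: (graded_subspace_ind gL (subspace_preim (rho K) (span_subspace _))) Lx.
move=> n y Ly; rewrite (proj1 (toep_compP K n)) => -[_ [c _ <-] [z Fz yE]].
apply: span_gen; split; first by exists y.
exists n, c => //.
by rewrite -yE linearD linearZ /= rho_tpow (toepF_rho0 (toepFn_sub Fz)) addr0.
Qed.

(** U is spanned by the homogeneous elements of L in P_K + K w, which makes it
    graded by construction.  A homogeneous x in L differs from one of them by an
    element of s: write x = c e^n + y with y in F_n and y = d w modulo s, where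
    d can be taken to be 0 unless n = 0. *)
Lemma lie_ideal_sumset L : lie_ideal L -> graded L -> s `<=` L -> ~ L w ->
  exists U : set T, [/\ graded U, U `<=` Pw, ~ U w & L = sumset s U].
Proof.
move=> [Ls Lie] gL sL Lw.
pose H := [set u | [/\ L u, Pw u & exists n, C n u]].
have Us : subspace (span H) by exact: span_subspace.
have UL : span H `<=` L by apply: span_ind => // u [].
exists (span H); split.
- apply: toep_gradedI => //.
  apply: span_ind => [|u Hu]; first exact: span_subspace.
  by apply: span_gen; split; [exact: span_gen | case: Hu].
- by apply: span_ind => [|u []]; first exact: subspacePw.
- by move/UL.
apply/seteqP; split=> [|_ [x sx [u Uu <-]]]; last first.
  exact: subspaceD Ls (sL _ sx) (UL _ Uu).
apply: (graded_subspace_ind gL (subspace_sumset ss Us)) => n x Lx Cx.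
move: (Cx); rewrite (proj1 (toep_compP K n)) => -[_ [c _ <-] [y Fy xE]].
have [d [syd yE]] : exists d, s (y - d *: w) /\ (n != 0 -> d = 0).
  case: (eqVneq n 0) => [_|n0]; last first.
    exists 0; split=> //; rewrite scale0r subr0.
    by move: Fy; rewrite -toep_s_comp // => -[].
  by have [d sd] := toepF_mod_s ss (@toep_s_munit K) (toepFn_sub Fy); exists d.
exists (y - d *: w) => //; exists (c *: tpow K n + d *: w); last first.
  by rewrite -xE addrC -addrA (addrC (d *: w)) subrK.
have uE : c *: tpow K n + d *: w = x - (y - d *: w).
  by rewrite -xE opprB -addrA [y + _]addrC subrK.
(* Otherwise a bracket of degree 0 would put a nonzero multiple of w in L. *)
have cn0 : c * n%:~R = 0.
  apply/eqP/negPn/negP => cn0; apply: Lw.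
  have [p [q pq]] := natB_surj (- n).
  have La := Lie (mono K p q) _ Lx.
  rewrite -[w](scalerK cn0); apply: (subspaceZ _ Ls).
  rewrite -[_ *: w](subKr (lie (mono K p q) x)); apply: (subspaceB Ls La).
  apply: sL; rewrite -xE lieDr lieZr addrAC -scalerA -scalerBr.
  apply: subspaceD ss _ (lie_toepF_s _ (toepFn_sub Fy)).
  by apply: subspaceZ ss _; exact: lie_tpow.
apply: span_gen; split.
- by rewrite uE; apply: subspaceB Ls Lx (sL _ syd).
- apply: subspaceD subspacePw _ (subspaceZ _ subspacePw tw_Pw).
  case: (eqVneq c 0) => [->|c0]; first by rewrite scale0r; case: subspacePw.
  have n0 : n%:~R = 0 :> K.
    by apply/eqP; move/eqP: cn0; rewrite mulf_eq0 (negPf c0).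
  by apply: (subspaceZ _ subspacePw); apply: toepP_Pw; exact: tpow_toepP.
exists n; apply: subspaceD (subspaceC K n) _ _.
  by apply: subspaceZ (subspaceC K n) _; exact: tpow_comp.
case: (eqVneq n 0) yE => [-> _|n0 ->] //; last first.
  by rewrite scale0r; case: (subspaceC K n).
apply: subspaceZ (subspaceC K 0) _.
by rewrite -munit00; apply: toepFn_comp; exact: toepFn_munit.
Qed.

End LieIdeals.

Theorem corollary4p12 (K : fieldType) :
  dirsum [set: toeplitz K] (toep_comp K)
  /\ (forall n : int, 0 < n ->
        dirsum2 (toep_comp K n) (line (te K ^+ `|n|%N)) (toepFn K n))
  /\ dirsum2 (toep_comp K 0) (line (1 : toeplitz K)) (toepFn K 0)
  /\ (forall n : int, n < 0 ->
        dirsum2 (toep_comp K n) (line (tes K ^+ `|n|%N)) (toepFn K n))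
  /\ dirsum (toepF K) (toepFn K)
  /\ graded_subspace (toep_comp K) (toep_s K)
  /\ (forall n : int, n != 0 -> toep_s K `&` toep_comp K n = toepFn K n)
  /\ toep_s K `&` toep_comp K 0 = toep_s0 K
  /\ (forall L : set (toeplitz K),
        lie_ideal L /\ graded_subspace (toep_comp K) L <->
        [\/ L = [set 0],
            L = line 1,
            (exists U : set (toeplitz K),
               [/\ graded_subspace (toep_comp K) U,
                   U `<=` sumset (toepP K) (line (tw K)),
                   ~ U (tw K) &
                   L = sumset (toep_s K) U]) |
            (exists W : set (laurent K),
               graded_subspace (laurent_comp K) W /\ L = rho K @^-1` W)]).
Proof.
have tcomp n := toep_compP K n.
split; first exact: toep_dirsum.
split; first by case.
split; first exact: tcomp.
split; first by case=> // n _; rewrite abszN.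
split; first exact: toepF_dirsum.
split; first exact: toep_s_graded.
split; first exact: toep_s_comp.
split; first exact: toep_s_comp0.
move=> L; split=> [[LL gL]|]; last first.
  case=> [->|->|[U [gU UP _ ->]]|[W [gW ->]]].
  - exact: zero_graded_lie_ideal.
  - exact: scalars_graded_lie_ideal.
  - exact: sumset_graded_lie_ideal.
  - exact: preimage_graded_lie_ideal.
have Ls := proj1 LL.
have [Lscal|/existsNP[x /not_implyP[Lx x1]]] := pselect (L `<=` line 1).
  have [L1|L1] := pselect (L 1).
    apply: Or42; apply/seteqP; split=> // _ [c _ <-]; exact: subspaceZ Ls L1.
  apply: Or41; apply/seteqP; split=> [x Lx|_ ->]; last by case: Ls.
  have [c _ xE] := Lscal x Lx; rewrite -xE in Lx *.
  case: (eqVneq c 0) => [->|c0]; first by rewrite /= scale0r.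
  by case: L1; rewrite -[1](scalerK c0); exact: subspaceZ Ls Lx.
have sL := s_sub_lie_ideal LL Lx x1.
have [Lw|Lw] := pselect (L (tw K)).
  by apply: Or44; exact: lie_ideal_preimage.
by apply: Or43; exact: lie_ideal_sumset.
Qed.
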